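(* There is an absolute constant $C>0$ such that for every $r$ with $\frac12<r<1$ the following holds. Let $L=\left[\frac{1}{1-r}\right]$, let $a_n = r e^{2\pi i n(1-r)}$ for $1\le n\le L$, and let $\mathbf{a}_r=(a_n)_{n=1}^{L}$. Then for every $f\in L^2(\mathbb{T})$, $$\| T^{\mathbf{a}_r} f\|_{L^2(\mathbb{T})}\le C\,\|f\|_{L^2(\mathbb{T})},$$ where $T^{\mathbf{a}_r}$ is the maximal partial sum operator of the Malmquist-Takenaka system associated to $\mathbf{a}_r$. In particular $C$ does not depend on $r$.
   Context: $\mathbb{T}$ is the unit circle, $[x]$ is the integer part of $x$, and $\langle f,g\rangle=\frac1{2\pi}\int_{-\pi}^{\pi} f(e^{i\theta})\overline{g(e^{i\theta})}\,d\theta$ is the inner product of $L^2(\mathbb{T})$. For a finite sequence $\mathbf{a}=(a_n)_{n=1}^{L}$ of points of the open unit disk, the Blaschke products are $B_0=1$ and $$B_n(z)=\prod_{j=1}^n \frac{\overline{a_j}}{|a_j|}\,\frac{z-a_j}{1-\overline{a_j}z},$$ and the associated Malmquist-Takenaka (MT) system is $$\phi_n(z)=B_n(z)\,\frac{\sqrt{1-|a_{n+1}|^2}}{1-\overline{a_{n+1}}z},\qquad 0\le n\le L-1 .$$ The maximal partial sum operator is $$T^{\mathbf{a}}f(x)=\sup_{0\le n\le L-1}\left|\sum_{j=0}^n\langle f,\phi_j\rangle\,\phi_j(e^{ix})\right| ,$$ regarded as a function on $\mathbb{T}$ via $x\mapsto e^{ix}$. *)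

(* Defs.v *)
From HB Require Import structures.
From mathcomp Require Import all_boot all_order all_algebra.
From mathcomp Require Import complex.
From mathcomp Require Import all_classical all_reals all_analysis.
Set Implicit Arguments.
Unset Strict Implicit.
Unset Printing Implicit Defensive.
Import Order.TTheory GRing.Theory Num.Theory.
Import numFieldNormedType.Exports.
Local Open Scope ring_scope.
Local Open Scope complex_scope.

(* Functions on the unit circle are functions R[i] -> R[i] of which only the
   values at the points expi theta matter. *)
Definition expi (R : realType) (theta : R) : R[i] := cos theta +i* sin theta.

(* Real-valued modulus; the order-theoretic norm `|z| of z : R[i] is R[i]-valued. *)
Definition modulus (R : realType) (z : R[i]) : R := Normc.normc z.

Lemma ltNpipi (R : realType) : - pi < pi :> R.
Proof. by rewrite gtrN // pi_gt0. Qed.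

(* The measure d theta / (2 pi) on [-pi, pi]. *)
Definition circle_measure (R : realType) : {measure set (measurableTypeR R) -> \bar R} :=
  uniform_prob (@ltNpipi R).

Definition L2norm (R : realType) (f : R[i] -> R[i]) : \bar R :=
  ('N[circle_measure R]_2%:E[(fun theta => (modulus (f (expi theta)))%:E)])%E.

(* Measurability is Borel measurability: every L^2 class has a Borel
   representative, and nothing below depends on the representative. *)
Definition in_L2 (R : realType) (f : R[i] -> R[i]) : Prop :=
  [/\ measurable_fun setT (fun theta : R => complex.Re (f (expi theta))),
      measurable_fun setT (fun theta : R => complex.Im (f (expi theta))) &
      (L2norm f < +oo)%E].

Definition inner (R : realType) (f g : R[i] -> R[i]) : R[i] :=
  let h theta := f (expi theta) * (g (expi theta))^* in
  (\int[circle_measure R]_theta complex.Re (h theta)) +i*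
  (\int[circle_measure R]_theta complex.Im (h theta)).

(* A finite sequence (a_1, ..., a_L) is a function a : nat -> R[i] together with
   its length L; a 0 and the a n with n > L are never used when n < L below. *)
Definition blaschke (R : realType) (a : nat -> R[i]) (n : nat) (z : R[i]) : R[i] :=
  \prod_(1 <= j < n.+1)
    ((a j)^* / (modulus (a j))%:C * ((z - a j) / (1 - (a j)^* * z))).

Definition MT (R : realType) (a : nat -> R[i]) (n : nat) (z : R[i]) : R[i] :=
  blaschke a n z *
  ((Num.sqrt (1 - modulus (a n.+1) ^+ 2))%:C / (1 - (a n.+1)^* * z)).

(* The supremum over 0 <= n <= L-1 is finite and of nonnegative numbers, hence
   the iterated maximum with default value 0. *)
Definition MT_maximal (R : realType) (L : nat) (a : nat -> R[i])
    (f : R[i] -> R[i]) (z : R[i]) : R :=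
  \big[Num.max/0]_(0 <= n < L)
    modulus (\sum_(0 <= j < n.+1) inner f (MT a j) * MT a j z).

Definition points_length (R : realType) (r : R) : nat := Num.truncn (1 - r)^-1.

Definition points (R : realType) (r : R) (n : nat) : R[i] :=
  r%:C * expi (2 * pi * n%:R * (1 - r)).

(* Main.v *)
(* Write delta = 1 - r and let U_n(x) be the n-th partial sum of sum_j c_j phi_j. Away from its zero
   the negative of a Blaschke factor is 1 + O(delta / distance), so at distance d delta from the
   n-th point, U_n is essentially unchanged when x moves by less than d delta. Sampled at the zeros
   a_k themselves the system is lower triangular, because phi_j(a_k) = 0 for k < j, and equal
   spacing makes it, up to a diagonal factor, a Toeplitz matrix whose kernel telescopes and hence
   has bounded partial sums. This matrix is bounded on l^2: by Christoffel-Darboux its Gram matrix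
   is the Szego kernel at the points a_k, which is dominated, as a quadratic form, by the Poisson
   kernel. Cotlar's argument then bounds U_n to the right of its truncation point by discrete
   maximal functions; reading the sequence backwards treats the tails. To avoid wrapping around the
   circle the points are split into 16 arcs. The resulting bound holds for arbitrary coefficients,
   so Bessel's inequality (with a constant) follows by duality. *)
Require Import Defs.
From mathcomp Require Import all_boot all_order all_algebra.
From mathcomp Require Import complex ring lra zify.
From mathcomp Require Import all_classical all_reals all_analysis.
From mathcomp Require Import measurable_realfun.
Set Implicit Arguments.
Unset Strict Implicit.
Unset Printing Implicit Defensive.
Import Order.TTheory GRing.Theory Num.Theory.
Import numFieldNormedType.Exports.
(* ring_scope is opened last so that [z^*] is Num.conj, as in the products of Defs. *)
Local Open Scope complex_scope.
Local Open Scope ring_scope.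

(** * Complex numbers and points of the circle *)

(** Positions are measured in units of the spacing, so a cell of unit length has measure $\delta$
    for $d\theta/2\pi$. Sampled sums of squares are bounded by $O(1/\delta)$ times the sum of the
    $|c_j|^2$; the length of a cell cancels this factor, which is why no $r$ survives in the
    constant.

    The diagonal factor is a product of Blaschke factors at distances $s=1,2,\dots$ from their
    zeros. It stays away from 0 because $|b(s)|^{-2}\le 1+144/s^2$, and this holds only while the
    distances stay below three quarters of a turn. The recurring condition [(1 - r) * n%:R <= 3 / 4]
    records that restriction, and it forces the arcs. The kernel telescopes because
    $(1-r^2)K=1-r\,b$ for the Szego kernel $K$ at radius $r^2$ and the factor $b$.

    The supremum over truncations becomes a choice, for each cell $m$, of a width $d$ in the kernel
    $d/(d+|m-j|)^2$. The $\ell^2$ bound does not depend on that choice, because composing two such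
    kernels gives at most a multiple of their sum. *)

Section modulus.
Context {R : realType}.
Implicit Types (z w : R[i]).

Lemma conjE z : z^* = complex.Re z -i* complex.Im z.
Proof. by case: z. Qed.

Lemma conjR (x : R) : (x%:C)^* = x%:C :> R[i].
Proof. by rewrite conjE /= oppr0. Qed.

Lemma modulus_ge0 z : 0 <= modulus z.
Proof. by case: z => a b; exact: sqrtr_ge0. Qed.

Lemma modulusM z w : modulus (z * w) = modulus z * modulus w.
Proof. exact: Normc.normcM. Qed.

Lemma modulusV z : modulus z^-1 = (modulus z)^-1.
Proof. exact: Normc.normcV. Qed.

Lemma modulusN z : modulus (- z) = modulus z.
Proof. exact: normcN. Qed.

Lemma modulusD z w : modulus (z + w) <= modulus z + modulus w.
Proof. exact: le_normcD. Qed.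

Lemma modulusB z w : modulus (z - w) <= modulus z + modulus w.
Proof. by rewrite -(modulusN w); exact: modulusD. Qed.

Lemma modulus0 : modulus (0 : R[i]) = 0.
Proof. exact: Normc.normc0. Qed.

Lemma modulus1 : modulus (1 : R[i]) = 1.
Proof. exact: Normc.normc1. Qed.

Lemma modulus_eq0 z : (modulus z == 0) = (z == 0).
Proof.
apply/eqP/eqP => [|->]; [exact: Normc.eq0_normc | exact: modulus0].
Qed.

Lemma modulus_gt0 z : (0 < modulus z) = (z != 0).
Proof. by rewrite lt_def modulus_ge0 andbT modulus_eq0. Qed.

Lemma modulusJ z : modulus z^* = modulus z.
Proof. by rewrite conjE; case: z => a b; rewrite /modulus /= sqrrN. Qed.

Lemma modulusR (x : R) : modulus x%:C = `|x|.
Proof. by rewrite /modulus /= expr0n addr0 sqrtr_sqr. Qed.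

Lemma sqr_modulus z : modulus z ^+ 2 = complex.Re z ^+ 2 + complex.Im z ^+ 2.
Proof. by case: z => a b; rewrite /modulus /= sqr_sqrtr// addr_ge0 ?sqr_ge0. Qed.

Lemma sqr_modulusC z : (modulus z ^+ 2)%:C = z * z^*.
Proof.
rewrite sqr_modulus conjE; case: z => a b /=.
apply/eqP; rewrite eq_complex /=; apply/andP; split; apply/eqP; ring.
Qed.

Lemma modulus_sum I (s : seq I) (P : pred I) (F : I -> R[i]) :
  modulus (\sum_(i <- s | P i) F i) <= \sum_(i <- s | P i) modulus (F i).
Proof.
elim/big_ind2: _ => [|a b c d ab cd|//]; first by rewrite modulus0.
apply: (le_trans (modulusD _ _)); exact: lerD.
Qed.

Lemma modulus_prod I (s : seq I) (P : pred I) (F : I -> R[i]) :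
  modulus (\prod_(i <- s | P i) F i) = \prod_(i <- s | P i) modulus (F i).
Proof. by 
apply: (big_morph _ _ modulus1); exact: modulusM. Qed.

Lemma conjM z w : (z * w)^* = z^* * w^*.
Proof. exact: rmorphM. Qed.

Lemma conj_sum I (s : seq I) (P : pred I) (F : I -> R[i]) :
  (\sum_(i <- s | P i) F i)^* = \sum_(i <- s | P i) (F i)^*.
Proof. by rewrite rmorph_sum. Qed.

Lemma sqr_modulus_sum I (s : seq I) (F : I -> R[i]) :
  (modulus (\sum_(i <- s) F i) ^+ 2)%:C = \sum_(i <- s) \sum_(j <- s) F i * (F j)^*.
Proof.
rewrite sqr_modulusC conj_sum mulr_suml; apply: eq_bigr => i _.
by rewrite mulr_sumr.
Qed.

Lemma modulus_signr n : modulus ((-1) ^+ n : R[i]) = 1.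
Proof. by elim: n => [|n IH]; rewrite ?expr0 ?modulus1// exprS modulusM modulusN modulus1 IH mulr1. Qed.

Lemma modulus_ge_Re z : `|complex.Re z| <= modulus z.
Proof.
rewrite -(@ler_pXn2r _ 2)// ?nnegrE ?modulus_ge0// real_normK ?num_real// sqr_modulus.
by rewrite lerDl sqr_ge0.
Qed.

Lemma Re_sum I (s : seq I) (P : pred I) (F : I -> R[i]) :
  complex.Re (\sum_(i <- s | P i) F i) = \sum_(i <- s | P i) complex.Re (F i).
Proof. by apply: (big_morph _ _ (erefl _)) => -[a b] [c d]. Qed.

Lemma modulus_prod_le1 (m n : nat) (x : nat -> R[i]) :
  (forall i, (m <= i < n)%N -> modulus (x i) <= 1) ->
  modulus (\prod_(m <= i < n) x i) <= 1.
Proof.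
move=> xb; rewrite modulus_prod big_nat.
suff /andP[] : 0 <= \prod_(m <= i < n | (m <= i < n)%N) modulus (x i) <= 1 by [].
elim/big_ind: _ => [|a b /andP[a0 a1] /andP[b0 b1]|i /xb ->].
- by rewrite ler01 lexx.
- by rewrite mulr_ge0//= mulr_ile1.
- by rewrite modulus_ge0.
Qed.

(** Factors are exchanged one at a time; all the others lie in the closed unit disk, so each
    exchange costs at most the distance between the two factors. *)
Lemma modulus_prodB (n : nat) (x y : nat -> R[i]) :
  (forall i, (i < n)%N -> modulus (x i) <= 1) ->
  (forall i, (i < n)%N -> modulus (y i) <= 1) ->
  modulus (\prod_(0 <= i < n) x i - \prod_(0 <= i < n) y i) <=
  \sum_(0 <= i < n) modulus (x i - y i).
Proof.
elim: n => [|n IH] xb yb; first by rewrite !big_nil subrr modulus0.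
rewrite !big_nat_recr//=.
set p := \prod_(_ <= _ < _) x _; set q := \prod_(_ <= _ < _) y _.
have -> : p * x n - q * y n = (p - q) * x n + q * (x n - y n) by ring.
apply: (le_trans (modulusD _ _)); rewrite !modulusM; apply: lerD.
  apply: le_trans (IH _ _); [|by move=> i /ltnW; apply: xb|by move=> i /ltnW; apply: yb].
  by rewrite ler_piMr ?modulus_ge0// xb.
rewrite ler_piMl ?modulus_ge0// /q; apply: modulus_prod_le1 => i /andP[_ /ltnW].
exact: yb.
Qed.

End modulus.

Section expi.
Context {R : realType}.
Implicit Types (a b s x y : R).

Lemma expi0 : expi 0 = 1 :> R[i].
Proof. by rewrite /expi cos0 sin0. Qed.

Lemma expiD a b : expi (a + b) = expi a * expi b.
Proof.
rewrite /expi cosD sinD; apply/eqP; rewrite eq_complex /=.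
by apply/andP; split; apply/eqP; ring.
Qed.

Lemma expiN a : expi (- a) = (expi a)^*.
Proof. by rewrite conjE /expi cosN sinN. Qed.

Lemma modulus_expi a : modulus (expi a) = 1.
Proof. by rewrite /modulus /expi /= cos2Dsin2 sqrtr1. Qed.

Lemma expi_neq0 a : expi a != 0.
Proof. by rewrite -modulus_gt0 modulus_expi. Qed.

Lemma expiNV a : expi (- a) = (expi a)^-1.
Proof.
apply: (mulfI (expi_neq0 a)).
by rewrite -expiD subrr expi0 divff ?expi_neq0.
Qed.

Lemma expiB a b : expi (a - b) = expi a / expi b.
Proof. by rewrite expiD expiNV. Qed.

Lemma expiD2pi a (n : nat) : expi (a + (2 * pi) * n%:R) = expi a.
Proof.
elim: n => [|n IH]; first by rewrite mulr0 addr0.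
rewrite -[in RHS]IH /expi.
have -> : a + 2 * pi * n.+1%:R = (a + 2 * pi * n%:R) + pi *+ 2.
  by rewrite -natr1 -[pi *+ 2]mulr_natl; ring.
by rewrite cosD2pi sinD2pi.
Qed.

Lemma sin_le_abs x : `|sin x| <= `|x|.
Proof.
wlog x0 : x / 0 <= x.
  move=> H; have [|/ltW x0] := leP 0 x; first exact: H.
  by rewrite -normrN -sinN -(normrN x); apply: H; rewrite oppr_ge0.
have [|c _ /=] := @MVT_segment R sin cos 0 x x0 (fun y _ => is_derive_sin y).
  by apply: continuous_subspaceT; exact: continuous_sin.
rewrite sin0 !subr0 => ->; rewrite normrM ler_piMl ?normr_ge0//.
exact: cos_max.
Qed.

Lemma cos_ge x : 1 - x ^+ 2 / 2 <= cos x.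
Proof.
have -> : cos x = 1 - 2 * sin (x / 2) ^+ 2.
  have {1}-> : x = (x / 2) *+ 2 by rewrite -mulr_natr; field.
  by rewrite cos_mulr2n cos2sin2 -mulr_natr; ring.
have : sin (x / 2) ^+ 2 <= (x / 2) ^+ 2.
  rewrite -(real_normK (num_real (sin _))) -(real_normK (num_real (x / 2))).
  by rewrite ler_pXn2r ?nnegrE//; exact: sin_le_abs.
by nra.
Qed.

(** The slope is crude; what matters is that the range passes [pi / 2], so that distances up to
    three quarters of a turn are covered. Beyond [pi / 2] the bound follows by reflection in
    [pi]. *)
Lemma sin_lb x : 0 <= x -> x <= 3 / 4 * pi -> x / 12 <= sin x.
Proof.
have pi2 := pi_ge2 R; have pi4 : pi < 4 :> R by have := pihalf_lt2 R; lra.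
have small y : 0 <= y -> y <= 1 -> y / 2 <= sin y.
  move=> y0 y1.
  have [|c + /=] := @MVT_segment R sin cos 0 y y0 (fun z _ => is_derive_sin z).
    by apply: continuous_subspaceT; exact: continuous_sin.
  rewrite in_itv/= sin0 !subr0 => /andP[c0 cy] ->.
  have := cos_ge c.
  have : c ^+ 2 <= 1 by nra.
  by nra.
have mid y : 0 <= y -> y <= pi / 2 -> y / 4 <= sin y.
  move=> y0 yp; have [y1|y1] := leP y 1; first by have := small _ y0 y1; lra.
  apply: (@le_trans _ _ (sin 1)); first by have := small 1 ler01 (lexx _); lra.
  apply: ltW; rewrite ltr_sin// in_itv/=; apply/andP; split; lra.
move=> x0 x1; have [xp|xp] := leP x (pi / 2); first by have := mid _ x0 xp; lra.
have -> : sin x = sin (pi - x) by rewrite sinB sinpi cospi; ring.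
have := @mid (pi - x) _ _; lra.
Qed.

Lemma modulus_1B_sqr (rho phi : R) :
  modulus (1 - rho%:C * expi phi) ^+ 2 =
  (1 - rho) ^+ 2 + 4 * rho * sin (phi / 2) ^+ 2.
Proof.
rewrite sqr_modulus /expi /=.
have e : cos phi = 1 - 2 * sin (phi / 2) ^+ 2.
  have {1}-> : phi = (phi / 2) *+ 2 by rewrite -mulr_natr; field.
  by rewrite cos_mulr2n cos2sin2 -mulr_natr; ring.
have := cos2Dsin2 phi; rewrite e; set s := sin phi; set t := sin (_ / _) => h.
have -> : (1 - (rho * (1 - 2 * t ^+ 2) - 0 * s)) ^+ 2 +
    (0 - (rho * s + 0 * (1 - 2 * t ^+ 2))) ^+ 2 =
    (1 - rho * (1 - 2 * t ^+ 2)) ^+ 2 + rho ^+ 2 * s ^+ 2 by ring.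
have -> : s ^+ 2 = 1 - (1 - 2 * t ^+ 2) ^+ 2 by lra.
by ring.
Qed.

Lemma expi_lip a b : modulus (expi a - expi b) <= `|a - b|.
Proof.
have -> : expi a - expi b = - (expi b * (1 - 1%:C * expi (a - b))).
  have := expi_neq0 b => b0.
  by rewrite expiB mul1r mulrBr mulr1 [_ / _]mulrC mulrA divff// mul1r opprB.
rewrite modulusN modulusM modulus_expi mul1r.
rewrite -(@ler_pXn2r _ 2)// ?nnegrE ?modulus_ge0//.
rewrite modulus_1B_sqr subrr expr0n add0r mulr1 real_normK ?num_real//.
have : sin ((a - b) / 2) ^+ 2 <= ((a - b) / 2) ^+ 2.
  rewrite -(real_normK (num_real (sin _))) -(real_normK (num_real (_ / 2))).
  by rewrite ler_pXn2r ?nnegrE//; exact: sin_le_abs.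
have -> : ((a - b) / 2) ^+ 2 = (a - b) ^+ 2 / 4 by field.
lra.
Qed.

End expi.

(** * A discrete maximal theorem *)

Section maximal.
Context {R : realType}.

(** A discrete average of Poisson type at scale [d]: of size $1/d$ up to distance $d$, with tail
    $d/|m-j|^2$. *)
Definition avg_ker (d m j : nat) : R := d%:R / (d%:R + `|m%:R - j%:R|) ^+ 2.

Lemma avg_ker_ge0 d m j : 0 <= avg_ker d m j.
Proof. by rewrite /avg_ker divr_ge0// exprn_ge0// addr_ge0. Qed.

Lemma avg_kerC d m j : avg_ker d m j = avg_ker d j m.
Proof. by rewrite /avg_ker distrC. Qed.

Lemma sum_avg_ker d m n : (0 < d)%N -> \sum_(j < n) avg_ker d m j <= 3.
Proof.
move=> d0.
have d1 : 1 <= d%:R :> R by rewrite ler1n.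
(* A discrete primitive dominating the kernel. Each side contributes at most 1, and the jump of size
   1 between [m] and [m.+1] pays for the central term. *)
pose Phi (j : nat) : R := if (j <= m)%N then d%:R / (d%:R + (m%:R - j%:R))
  else 3 - d%:R / (d%:R + (j%:R - m%:R - 1)).
have Phi0 j : 0 <= Phi j <= 3.
  rewrite /Phi; case: leqP => [jm|mj].
    have : j%:R <= m%:R :> R by rewrite ler_nat.
    move=> h; rewrite divr_ge0//=; last lra.
    rewrite ler_pdivrMr; lra.
  have : m%:R + 1 <= j%:R :> R by rewrite natr1 ler_nat.
  move=> h; apply/andP; split; last first.
    by rewrite gerDl oppr_le0 divr_ge0//; lra.
  have : d%:R / (d%:R + (j%:R - m%:R - 1)) <= 1 :> R by rewrite ler_pdivrMr; lra.
  lra.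
suff H : \sum_(j < n) avg_ker d m j <= \sum_(0 <= j < n) (Phi j.+1 - Phi j).
  apply: (le_trans H); rewrite telescope_sumr//.
  have := Phi0 n; have := Phi0 0%N; lra.
rewrite big_mkord; apply: ler_sum => -[j /= _] _.
have frac (a : R) : d%:R <= a -> d%:R / (a + 1) ^+ 2 <= d%:R / a - d%:R / (a + 1).
  move=> da; have -> : d%:R / a - d%:R / (a + 1) = d%:R / (a * (a + 1)).
    by field; lra.
  by rewrite ler_wpM2l// lef_pV2 ?posrE; nra.
rewrite /avg_ker /Phi; case: (ltngtP j m) => [jm|mj|->].
- have h : j%:R + 1 <= m%:R :> R by rewrite natr1 ler_nat.
  rewrite ger0_norm; last lra.
  have := frac (d%:R + (m%:R - j%:R) - 1); rewrite subrK => /(_ _)/le_trans; apply; first lra.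
  by rewrite -natr1 !opprD !addrA lexx.
- have h : m%:R + 1 <= j%:R :> R by rewrite natr1 ler_nat.
  rewrite ler0_norm; last lra.
  have := frac (d%:R + (j%:R - m%:R - 1)).
  have -> : d%:R + (j%:R - m%:R - 1) + 1 = d%:R - (m%:R - j%:R) :> R by ring.
  move=> /(_ _)/le_trans; apply; first lra.
  have -> : d%:R + (j.+1%:R - m%:R - 1) = d%:R - (m%:R - j%:R) :> R by rewrite -natr1; ring.
  lra.
- have -> : m.+1%:R - m%:R - 1 = 0 :> R by rewrite -natr1; ring.
  rewrite subrr normr0 !addr0 divff; last lra.
  rewrite ler_pdivrMr ?exprn_gt0//; nra.
Qed.

Lemma avg_ker_quarter d m m' j : (0 < d)%N -> `|m%:R - m'%:R| <= 2 * `|m%:R - j%:R| :> R ->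
  avg_ker d m j <= 4 * avg_ker d m m'.
Proof.
move=> d0 h.
have d1 : 1 <= d%:R :> R by rewrite ler1n.
rewrite /avg_ker; move: h; set x := `|m%:R - m'%:R|; set y := `|_| => h.
have x0 : 0 <= x by exact: normr_ge0.
have y0 : 0 <= y by exact: normr_ge0.
rewrite mulrCA ler_wpM2l//.
have -> : 4 * ((d%:R + x) ^+ 2)^-1 = (((d%:R + x) / 2) ^+ 2)^-1 by field; lra.
rewrite lef_pV2 ?posrE ?exprn_gt0//; last 2 first; try lra.
rewrite ler_pXn2r ?nnegrE//; lra.
Qed.

(** Every [j] is at distance at least $|m-m'|/2$ from [m] or from [m']. The kernel of the far point
    is then at most 4 times its value at the pair, and the other one sums to at most 3. *)
Lemma avg_ker_conv d d' m m' n : (0 < d)%N -> (0 < d')%N ->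
  \sum_(j < n) avg_ker d m j * avg_ker d' m' j <= 12 * (avg_ker d m m' + avg_ker d' m m').
Proof.
move=> d0 d0'.
have H j : avg_ker d m j * avg_ker d' m' j <=
    4 * avg_ker d m m' * avg_ker d' m' j + 4 * avg_ker d' m m' * avg_ker d m j.
  have p1 := avg_ker_ge0 d m j; have p2 := avg_ker_ge0 d' m' j.
  have p3 := avg_ker_ge0 d m m'; have p4 := avg_ker_ge0 d' m m'.
  have [h|h] := leP (`|m%:R - m'%:R| : R) (2 * `|m%:R - j%:R|).
    have /(ler_wpM2r p2) := avg_ker_quarter d0 h; have := mulr_ge0 p4 p1; lra.
  have /(avg_ker_quarter d0') : `|m'%:R - m%:R| <= 2 * `|m'%:R - j%:R| :> R.
    rewrite distrC; have := ler_distD (j%:R : R) m%:R m'%:R; rewrite (distrC j%:R); lra.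
  rewrite (avg_kerC _ m' m) => /(ler_wpM2l p1); have := mulr_ge0 p3 p2; lra.
apply: (@le_trans _ _ (\sum_(j < n) (4 * avg_ker d m m' * avg_ker d' m' j +
    4 * avg_ker d' m m' * avg_ker d m j))); first by apply: ler_sum => j _; exact: H.
rewrite big_split/= -[X in X + _]mulr_sumr -[X in _ + X]mulr_sumr.
have s1 := sum_avg_ker m' n d0'; have s2 := sum_avg_ker m n d0.
have p3 := avg_ker_ge0 d m m'; have p4 := avg_ker_ge0 d' m m'.
have := ler_wpM2l p3 s1; have := ler_wpM2l p4 s2; lra.
Qed.

(* The adjoint of the operator linearized by [d]: [T T*] is dominated by [T + T*] entrywise,
   which bounds its own norm. *)
Lemma avg_ker_adjoint (d : nat -> nat) (M n : nat) (h : nat -> R) :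
  (forall m, 0 < d m)%N -> (forall m, 0 <= h m) ->
  \sum_(j < n) (\sum_(m < M) avg_ker (d m) m j * h m) ^+ 2 <= 576 * \sum_(m < M) h m ^+ 2.
Proof.
move=> d0 h0.
(* Once the range of [j] contains that of [m], the sum of the [t m ^+ 2] is at most [X], which [H3]
   requires. *)
wlog Mn : n / (M <= n)%N => [H|].
  apply: le_trans (H (M + n)%N _); last by rewrite leq_addr.
  rewrite (addnC M) big_split_ord/= lerDl sumr_ge0// => *.
  exact: sqr_ge0.
pose t (j : nat) : R := \sum_(m < M) avg_ker (d m) m j * h m.
have t0 j : 0 <= t j.
  by apply: sumr_ge0 => m _; rewrite mulr_ge0// avg_ker_ge0.
rewrite -/(t _).
set X := \sum_(j < n) _.
have H1 : X = \sum_(m < M) \sum_(m' < M) h m * h m' *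
    (\sum_(j < n) avg_ker (d m) m j * avg_ker (d m') m' j).
  rewrite /X; under eq_bigr => j _.
    rewrite expr2 mulr_suml; under eq_bigr do rewrite mulr_sumr.
    over.
  rewrite exchange_big/=; apply: eq_bigr => m _.
  rewrite exchange_big/=; apply: eq_bigr => m' _.
  by rewrite mulr_sumr; apply: eq_bigr => j _; ring.
have H2 : X <= 24 * \sum_(m < M) h m * t m.
  rewrite H1.
  apply: (@le_trans _ _ (\sum_(m < M) \sum_(m' < M) h m * h m' *
    (12 * (avg_ker (d m) m m' + avg_ker (d m') m m')))).
    apply: ler_sum => m _; apply: ler_sum => m' _.
    rewrite ler_wpM2l ?mulr_ge0//; exact: avg_ker_conv.
  rewrite le_eqVlt; apply/orP; left; apply/eqP.
  pose a := \sum_(m < M) \sum_(m' < M) h m * h m' * avg_ker (d m) m m'.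
  have aE : \sum_(m < M) h m * t m = a.
    rewrite /t; under eq_bigr do rewrite mulr_sumr.
    rewrite exchange_big/=; apply: eq_bigr => m _; apply: eq_bigr => m' _; ring.
  have aE' : \sum_(m < M) \sum_(m' < M) h m * h m' * avg_ker (d m') m m' = a.
    rewrite exchange_big/=; apply: eq_bigr => m _; apply: eq_bigr => m' _.
    by rewrite avg_kerC (mulrC (h m')).
  have -> : 24 * \sum_(m < M) h m * t m = 12 * a + 12 *
      \sum_(m < M) \sum_(m' < M) h m * h m' * avg_ker (d m') m m'.
    by rewrite aE aE'; ring.
  rewrite !mulr_sumr -big_split/=; apply: eq_bigr => m _.
  rewrite !mulr_sumr -big_split/=; apply: eq_bigr => m' _; ring.
(* Together with [H2] this reads $2X\le 576\sum h^2+X$, and [X] is absorbed; hence $576=24^2$. *)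
have H3 : \sum_(m < M) 48 * (h m * t m) <= 576 * \sum_(m < M) h m ^+ 2 + X.
  apply: (@le_trans _ _ (576 * \sum_(m < M) h m ^+ 2 + \sum_(m < M) t m ^+ 2)).
    rewrite mulr_sumr -big_split/=; apply: ler_sum => m _.
    have := sqr_ge0 (24 * h m - t m); nra.
  rewrite lerD2l /X -(subnKC Mn) big_split_ord/= lerDl sumr_ge0// => *.
  exact: sqr_ge0.
rewrite -mulr_sumr in H3; lra.
Qed.

(** Since [d] is an arbitrary function of [m], this is a maximal theorem: the width may be the worst
    one at each point. It is dual to [avg_ker_adjoint], with the same constant. *)
Lemma avg_ker_maximal (d : nat -> nat) (M n : nat) (g : nat -> R) :
  (forall m, 0 < d m)%N -> (forall m, 0 <= g m) ->
  \sum_(m < M) (\sum_(j < n) avg_ker (d m) m j * g j) ^+ 2 <= 576 * \sum_(j < n) g j ^+ 2.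
Proof.
move=> d0 g0.
pose h (m : nat) : R := \sum_(j < n) avg_ker (d m) m j * g j.
have h0 m : 0 <= h m.
  by apply: sumr_ge0 => j _; rewrite mulr_ge0// avg_ker_ge0.
have A := avg_ker_adjoint M n d0 h0.
rewrite -/(h _); set X := \sum_(m < M) _ in A *.
pose t (j : nat) : R := \sum_(m < M) avg_ker (d m) m j * h m.
have H1 : X = \sum_(j < n) g j * t j.
  rewrite /X; under eq_bigr do rewrite expr2 mulr_suml.
  rewrite exchange_big/=; apply: eq_bigr => j _.
  by rewrite mulr_sumr; apply: eq_bigr => m _; ring.
have H2 : \sum_(j < n) 2 * (g j * t j) <= 576 * \sum_(j < n) g j ^+ 2 + X.
  have : 576^-1 * \sum_(j < n) t j ^+ 2 <= X by lra.
  move=> /(lerD (lexx (576 * \sum_(j < n) g j ^+ 2))); apply: le_trans.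
  rewrite !mulr_sumr -big_split/=; apply: ler_sum => j _.
  have := sqr_ge0 (24 * g j - t j / 24); nra.
rewrite -mulr_sumr -H1 in H2; lra.
Qed.

(** Linearizes a maximal operator: a supremum over finitely many widths is attained by one width for
    each point. *)
Lemma exists_argmax (A : nat -> nat -> R) (D : nat) : (0 < D)%N ->
  exists d : nat -> nat, (forall m, 0 < d m)%N /\
    forall m k, (0 < k <= D)%N -> A k m <= A (d m) m.
Proof.
case: D => // D _.
pose F m := [arg max_(i > (ord0 : 'I_D.+1)) A i.+1 m]%O.
exists (fun m => (F m).+1); split => // m [//|k] /= kD.
rewrite /F; case: arg_maxP => //= i _ /(_ (Ordinal kD)) /=; exact.
Qed.

End maximal.

(** * Szego kernels and Blaschke factors at equally spaced points *)

Section kernels.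
Context {R : realType}.
Variable r : R.
Implicit Types (rho s t : R) (w : R[i]).

(* The point of the circle at position [s], in units of the spacing of the sequence. *)
Definition turn s : R[i] := expi (2 * pi * (1 - r) * s).

Definition szego rho s : R[i] := (1 - rho%:C * turn s)^-1.

(* The opposite of the Blaschke factor of zero [r]: it is close to 1 away from its zero. *)
Definition bfactor w : R[i] := (r%:C - w) / (1 - r%:C * w).

Definition gam s : R[i] := bfactor (turn s).

Definition bet s : R[i] := bfactor (r%:C * turn s).

Hypothesis r_gt : 2^-1 < r.
Hypothesis r_lt : r < 1.

Lemma turnD s t : turn (s + t) = turn s * turn t.
Proof. by rewrite /turn mulrDr expiD. Qed.

Lemma turn0 : turn 0 = 1.
Proof. by rewrite /turn mulr0 expi0. Qed.

Lemma turnN s : turn (- s) = (turn s)^*.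
Proof. by rewrite /turn mulrN expiN. Qed.

Lemma turnNV s : turn (- s) = (turn s)^-1.
Proof. by rewrite /turn mulrN expiNV. Qed.

Lemma modulus_turn s : modulus (turn s) = 1.
Proof. exact: modulus_expi. Qed.

Lemma turn_neq0 s : turn s != 0.
Proof. exact: expi_neq0. Qed.

Lemma modulus_szego_den rho s : modulus (1 - rho%:C * turn s) ^+ 2 =
  (1 - rho) ^+ 2 + 4 * rho * sin (pi * (1 - r) * s) ^+ 2.
Proof.
by rewrite modulus_1B_sqr; have -> : 2 * pi * (1 - r) * s / 2 = pi * (1 - r) * s by field.
Qed.

Lemma modulus_den_ge rho s : 0 <= rho -> 1 - rho <= modulus (1 - rho%:C * turn s).
Proof.
move=> rho0; have [h|h] := leP (1 - rho) 0.
  by apply: (le_trans h); exact: modulus_ge0.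
rewrite -(@ler_pXn2r _ 2)// ?nnegrE ?modulus_ge0 ?(ltW h)// modulus_szego_den.
by rewrite lerDl mulr_ge0 ?sqr_ge0 ?mulr_ge0.
Qed.

Lemma den_neq0 rho s : 0 <= rho -> rho < 1 -> 1 - rho%:C * turn s != 0.
Proof.
move=> rho0 rho1; rewrite -modulus_gt0; apply: lt_le_trans (modulus_den_ge _ rho0).
by rewrite subr_gt0.
Qed.

Lemma modulus_szego_le rho s : 0 <= rho -> rho <= r -> modulus (szego rho s) <= (1 - r)^-1.
Proof.
have [rg rl] := (r_gt, r_lt).
move=> rho0 rho1; rewrite modulusV lef_pV2 ?posrE.
- by apply: le_trans (modulus_den_ge _ rho0); lra.
- by rewrite modulus_gt0 den_neq0//; lra.
- lra.
Qed.

Lemma sin_pos_lb s : 0 <= s -> (1 - r) * s <= 3 / 4 ->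
  ((1 - r) * s / 6) ^+ 2 <= sin (pi * (1 - r) * s) ^+ 2.
Proof.
have [rg rl] := (r_gt, r_lt).
move=> s0 s1; have p2 := pi_ge2 R.
have d0 : 0 <= (1 - r) * s by rewrite mulr_ge0//; lra.
set y := (1 - r) * s in d0 s1 *; have -> : pi * (1 - r) * s = pi * y by rewrite mulrA.
have h : pi * y / 12 <= sin (pi * y) by apply: sin_lb; nra.
have h' : y / 6 <= sin (pi * y) by apply: le_trans h; nra.
by rewrite ler_pXn2r ?nnegrE ?divr_ge0//; apply: le_trans h'; rewrite divr_ge0.
Qed.

(** The range of [rho] covers evaluation on the circle ([r]) and at the zeros ([r ^+ 2]). The
    denominator is at least $(1-r)\sqrt{1+s^2/36}$, and 9 is enough because $2/81\le 1/36$. *)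
Lemma modulus_szego rho s : r ^+ 2 <= rho -> rho <= r -> (1 - r) * `|s| <= 3 / 4 ->
  modulus (szego rho s) <= 9 / ((1 - r) * (1 + `|s|)).
Proof.
have [rg rl] := (r_gt, r_lt).
move=> rho0 rho1 s1.
have rho4 : 4^-1 <= rho by nra.
have d0 : 0 < (1 - r) * (1 + `|s|).
  apply: mulr_gt0; [lra|by rewrite ltr_pwDl].
rewrite modulusV -[9 / _]invrK lef_pV2 ?posrE.
- rewrite invf_div -(@ler_pXn2r _ 2)// ?nnegrE ?modulus_ge0 ?divr_ge0 ?(ltW d0)//.
  rewrite modulus_szego_den.
  have -> : sin (pi * (1 - r) * s) ^+ 2 = sin (pi * (1 - r) * `|s|) ^+ 2.
    have [s0|s0] := boolP (0 <= s); [by rewrite ger0_norm|by rewrite ltr0_norm ?ltNge// mulrN sinN sqrrN].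
  have := sin_pos_lb (normr_ge0 s) s1.
  set S := sin _ ^+ 2; have := normr_ge0 s; set x := `|s| => x0 h.
  have : ((1 - r) * x / 6) ^+ 2 <= 4 * rho * S.
    apply: (le_trans h); have : 0 <= S by exact: sqr_ge0.
    nra.
  have : (1 - r) ^+ 2 <= (1 - rho) ^+ 2 by rewrite ler_pXn2r ?nnegrE//; lra.
  have : 0 <= ((1 - r) * (1 - x)) ^+ 2 by exact: sqr_ge0.
  have : 0 <= ((1 - r)) ^+ 2 by exact: sqr_ge0.
  have : 0 <= ((1 - r) * x) ^+ 2 by exact: sqr_ge0.
  lra.
- by rewrite modulus_gt0 den_neq0//; lra.
- by rewrite invr_gt0 divr_gt0.
Qed.

Lemma turn_dist rho rho' s t : 0 <= rho -> rho <= 1 ->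
  modulus (rho%:C * turn s - rho'%:C * turn t) <= `|rho - rho'| + 8 * (1 - r) * `|s - t|.
Proof.
have [rg rl] := (r_gt, r_lt).
move=> rho0 rho1.
have -> : rho%:C * turn s - rho'%:C * turn t =
    (rho - rho')%:C * turn t + rho%:C * (turn s - turn t).
  by rewrite rmorphB; ring.
apply: (le_trans (modulusD _ _)); rewrite !modulusM modulus_turn mulr1 !modulusR lerD2l.
rewrite (ger0_norm rho0); apply: (@le_trans _ _ (modulus (turn s - turn t))).
  by rewrite ler_piMl// modulus_ge0.
apply: (le_trans (expi_lip _ _)).
have pi4 : pi < 4 :> R by have := pihalf_lt2 R; lra.
have p2 := pi_ge2 R.
rewrite -mulrBr normrM ler_wpM2r ?normr_ge0// ger0_norm; nra.
Qed.

Lemma szegoB rho rho' s t : 0 <= rho < 1 -> 0 <= rho' < 1 ->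
  szego rho s - szego rho' t =
  (rho%:C * turn s - rho'%:C * turn t) * szego rho s * szego rho' t.
Proof.
move=> /andP[a b] /andP[a' b']; rewrite /szego.
have := den_neq0 s a b; have := den_neq0 t a' b'.
by move=> h h'; field; rewrite h h'.
Qed.

Lemma bfactorB w w' : 1 - r%:C * w != 0 -> 1 - r%:C * w' != 0 ->
  bfactor w - bfactor w' =
  - ((1 - r ^+ 2)%:C * (w - w') * (1 - r%:C * w)^-1 * (1 - r%:C * w')^-1).
Proof.
by move=> h h'; rewrite /bfactor rmorphB rmorph1 rmorphXn; field; rewrite h h'.
Qed.

Lemma rturnE s : r%:C * (r%:C * turn s) = (r ^+ 2)%:C * turn s.
Proof. by rewrite mulrA rmorphXn expr2. Qed.

Lemma r2_lt1 : 0 <= r ^+ 2 < 1.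
Proof.
by have [rg rl] := (r_gt, r_lt); apply/andP; split; nra.
Qed.

Lemma r_lt1 : 0 <= r < 1.
Proof.
by have [rg rl] := (r_gt, r_lt); lra.
Qed.

Lemma modulus_gam s : modulus (gam s) = 1.
Proof.
have h : 1 - r%:C * turn s != 0 by have /andP[] := r_lt1; exact: den_neq0.
rewrite /gam /bfactor modulusM modulusV.
have -> : r%:C - turn s = - (turn s * (1 - r%:C * turn s)^*).
  rewrite rmorphB rmorphM rmorph1 /= conjR -turnN turnNV.
  by field; exact: turn_neq0.
by rewrite modulusN modulusM modulus_turn mul1r modulusJ divff// modulus_eq0.
Qed.

Lemma sqr_modulus_bet s : modulus (bet s) ^+ 2 =
  4 * r ^+ 2 * sin (pi * (1 - r) * s) ^+ 2 /
  ((1 - r ^+ 2) ^+ 2 + 4 * r ^+ 2 * sin (pi * (1 - r) * s) ^+ 2).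
Proof.
rewrite /bet /bfactor modulusM modulusV rturnE exprMn exprVn modulus_szego_den; congr (_ / _).
have -> : r%:C - r%:C * turn s = r%:C * (1 - 1%:C * turn s) by rewrite rmorph1; ring.
rewrite modulusM exprMn modulus_szego_den modulusR real_normK ?num_real//; ring.
Qed.

Lemma modulus_bet_le1 s : modulus (bet s) <= 1.
Proof.
have [rg rl] := (r_gt, r_lt).
rewrite -(@ler_pXn2r _ 2)// ?nnegrE ?modulus_ge0// expr1n sqr_modulus_bet.
have /andP[a b] := r2_lt1.
have c : 0 <= 4 * r ^+ 2 * sin (pi * (1 - r) * s) ^+ 2.
  exact: mulr_ge0 (mulr_ge0 (ler0n _ 4) (sqr_ge0 _)) (sqr_ge0 _).
have d : 0 < (1 - r ^+ 2) ^+ 2 by rewrite exprn_gt0// subr_gt0.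
rewrite ler_pdivrMr; lra.
Qed.

(** Here $144=4\cdot 36$: the 4 bounds $(1+r)^2$, the 36 comes from [sin_pos_lb], and $4r^2\ge
    1$. *)
Lemma sqr_modulus_bet_ge s : 0 < s -> (1 - r) * s <= 3 / 4 ->
  (1 + 144 / s ^+ 2)^-1 <= modulus (bet s) ^+ 2.
Proof.
have [rg rl] := (r_gt, r_lt).
move=> s0 s1; rewrite sqr_modulus_bet.
have := sin_pos_lb (ltW s0) s1; set S := sin _ ^+ 2 => h.
have S0 : 0 < S by apply: lt_le_trans h; rewrite exprn_gt0// divr_gt0// mulr_gt0//; lra.
have a : 0 < 4 * r ^+ 2 * S by rewrite mulr_gt0// mulr_gt0// exprn_gt0//; lra.
have b : 0 <= (1 - r ^+ 2) ^+ 2 by exact: sqr_ge0.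
rewrite -[leRHS]invrK lef_pV2 ?posrE; last 2 first.
- by rewrite ltr_pwDl// divr_ge0// exprn_ge0// ltW.
- by rewrite invr_gt0 divr_gt0//; lra.
rewrite invf_div mulrDl divff ?gt_eqF// addrC lerD2l.
rewrite ler_pdivrMr// mulrAC ler_pdivlMr ?exprn_gt0//.
have hb : (1 - r ^+ 2) ^+ 2 <= 4 * (1 - r) ^+ 2.
  have -> : (1 - r ^+ 2) ^+ 2 = (1 + r) ^+ 2 * (1 - r) ^+ 2 by ring.
  by rewrite ler_wpM2r ?sqr_ge0//; nra.
have ha : S <= 4 * r ^+ 2 * S by rewrite ler_peMl ?(ltW S0)//; nra.
have := ler_wpM2r (sqr_ge0 s) hb.
have e : ((1 - r) * s / 6) ^+ 2 = 36^-1 * ((1 - r) ^+ 2 * s ^+ 2) by field.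
rewrite e in h.
lra.
Qed.

Lemma bet_neq0 s : 0 < s -> (1 - r) * s <= 3 / 4 -> bet s != 0.
Proof.
move=> s0 s1; rewrite -modulus_eq0 -sqrf_eq0 gt_eqF//.
apply: lt_le_trans (sqr_modulus_bet_ge s0 s1).
by rewrite invr_gt0 ltr_pwDl// divr_ge0// exprn_ge0// ltW.
Qed.

Lemma modulus_1Bbet s : 0 <= s -> (1 - r) * s <= 3 / 4 -> modulus (1 - bet s) <= 18 / (1 + s).
Proof.
have [rg rl] := (r_gt, r_lt).
move=> s0 s1.
have [/andP[a b] /andP[a' b']] := (r2_lt1, r_lt1).
have -> : 1 - bet s = (1 - r)%:C * ((1 + r%:C * turn s) * szego (r ^+ 2) s).
  have := den_neq0 s a b; rewrite /bet /bfactor rturnE /szego => h.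
  rewrite rmorphXn rmorphB rmorph1 in h *.
  by field.
rewrite !modulusM modulusR gtr0_norm; last lra.
have h1 : modulus (1 + r%:C * turn s) <= 2.
  apply: (le_trans (modulusD _ _)); rewrite modulus1 modulusM modulus_turn modulusR ger0_norm//; lra.
have h2 := @modulus_szego (r ^+ 2) s (lexx _); rewrite (ger0_norm s0) in h2.
have {}h2 := h2 ltac:(nra) s1.
have -> : 18 / (1 + s) = (1 - r) * (2 * (9 / ((1 - r) * (1 + s)))) by field; lra.
rewrite ler_wpM2l//; first lra.
by apply: ler_pM => //; exact: modulus_ge0.
Qed.

(** The source of the telescoping in [kap_telescope]. *)
Lemma szego_bet s : (1 - r ^+ 2)%:C * szego (r ^+ 2) s = 1 - r%:C * bet s.
Proof.
have /andP[a b] := r2_lt1.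
have := den_neq0 s a b; rewrite /bet /bfactor rturnE /szego => h.
rewrite rmorphB rmorph1 rmorphXn in h *; by field.
Qed.

End kernels.

(** * Boundedness of the sampled system *)

Section gram.
Context {R : realType}.
Variable r : R.
Implicit Types (s t x y : R) (j k l n M : nat).

(* Up to unimodular factors and for [x = k%:R], the value of the [j]-th function of the system
   at its [k]-th zero. *)
Definition MTker x j : R[i] := (Num.sqrt (1 - r ^+ 2))%:C *
  (\prod_(0 <= i < j) bet r (x - i%:R) * szego r (r ^+ 2) (x - j%:R)).

Hypothesis r_gt : 2^-1 < r.
Hypothesis r_lt : r < 1.

Lemma bet0 : bet r 0 = 0.
Proof. by rewrite /bet /bfactor turn0 mulr1 subrr mul0r. Qed.

Lemma sqrt_1Br2 : ((Num.sqrt (1 - r ^+ 2))%:C : R[i]) * (Num.sqrt (1 - r ^+ 2))%:C = (1 - r ^+ 2)%:C.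
Proof.
have /andP[a b] := r2_lt1 r_gt r_lt.
by rewrite -rmorphM -expr2 sqr_sqrtr// subr_ge0 ltW.
Qed.

Lemma conj_turn s : (turn r s)^* = turn r (- s).
Proof. by rewrite turnN. Qed.

Lemma conj_szego rho s : (szego r rho s)^* = szego r rho (- s).
Proof. by rewrite /szego fmorphV rmorphB rmorph1 rmorphM /= conjR turnN. Qed.

(** One step of Christoffel-Darboux: multiplied by the two products of earlier factors, it is what a
    new function adds to the kernel. *)
Lemma bet_CD s t : (1 - r ^+ 2)%:C * szego r (r ^+ 2) s * (szego r (r ^+ 2) t)^* *
  (1 - (r ^+ 2)%:C * turn r (s - t)) = 1 - bet r s * (bet r t)^*.
Proof.
have /andP[a b] := r2_lt1 r_gt r_lt.
have hs := den_neq0 r s a b; have ht := den_neq0 r (- t) a b.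
have e : (bet r t)^* = (r%:C - r%:C * turn r (- t)) / (1 - (r ^+ 2)%:C * turn r (- t)).
  by rewrite /bet /bfactor rturnE fmorph_div !rmorphB rmorph1 !rmorphM /= !conjR conj_turn.
rewrite conj_szego e /bet /bfactor rturnE turnD /szego.
rewrite rmorphB rmorph1 rmorphXn in hs ht *.
by field; rewrite hs ht.
Qed.

Lemma MTker_CD x y n :
  (\sum_(0 <= j < n) MTker x j * (MTker y j)^*) * (1 - (r ^+ 2)%:C * turn r (x - y)) =
  1 - (\prod_(0 <= i < n) bet r (x - i%:R)) * (\prod_(0 <= i < n) bet r (y - i%:R))^*.
Proof.
elim: n => [|n IH]; first by rewrite !big_nil mul0r rmorph1 mulr1 subrr.
rewrite !big_nat_recr//= mulrDl IH.
have := bet_CD (x - n%:R) (y - n%:R).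
have -> : x - n%:R - (y - n%:R) = x - y by ring.
rewrite /MTker; set p := \prod_(_ <= _ < _) _; set q0 := \prod_(_ <= _ < _) _.
set W := 1 - _ * turn r (x - y); set B := bet r (x - _); set B0 := bet r _.
set S := szego _ _ _; set S0 := szego _ _ _.
rewrite !conjM conjR; set q := q0^*; set B' := B0^*; set S' := S0^*.
have -> : (Num.sqrt (1 - r ^+ 2))%:C * (p * S) * ((Num.sqrt (1 - r ^+ 2))%:C * (q * S')) * W =
  p * q * ((Num.sqrt (1 - r ^+ 2))%:C * (Num.sqrt (1 - r ^+ 2))%:C * S * S' * W) by ring.
rewrite sqrt_1Br2 => ->; ring.
Qed.

Lemma prod_bet0 k n : (k < n)%N -> \prod_(0 <= i < n) bet r (k%:R - i%:R) = 0.
Proof.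
move=> kn; rewrite big_mkord (bigD1 (Ordinal kn))//= subrr.
by rewrite bet0 mul0r.
Qed.

(** At the zero [k] the product in [MTker_CD] contains [bet r 0 = 0], so finitely many functions
    already reproduce the whole Szego kernel. *)
Lemma MTker_gram k l n : (k < n)%N ->
  \sum_(0 <= j < n) MTker k%:R j * (MTker l%:R j)^* = szego r (r ^+ 2) (k%:R - l%:R).
Proof.
move=> kn; have := MTker_CD k%:R l%:R n; rewrite prod_bet0// mul0r subr0.
have /andP[a b] := r2_lt1 r_gt r_lt.
have h := den_neq0 r (k%:R - l%:R) a b.
by move=> e; apply: (mulIf h); rewrite e /szego mulVf.
Qed.

Lemma MTker_adjoint_gram (lam : nat -> R[i]) n :
  (\sum_(0 <= j < n) modulus (\sum_(0 <= k < n) lam k * MTker k%:R j) ^+ 2)%:C =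
  \sum_(0 <= k < n) \sum_(0 <= l < n) lam k * (lam l)^* * szego r (r ^+ 2) (k%:R - l%:R).
Proof.
rewrite rmorph_sum /=; under eq_bigr => j _.
  rewrite sqr_modulus_sum.
  over.
rewrite exchange_big/= big_nat [RHS]big_nat; apply: eq_bigr => k /andP[_ kn].
rewrite exchange_big/=; apply: eq_bigr => l _.
rewrite -(MTker_gram l kn) mulr_sumr; apply: eq_bigr => j _.
by rewrite rmorphM; ring.
Qed.

(** The second summand is $\overline{K}-1$ for the Szego kernel $K$, and the right side is the
    Poisson kernel of radius $r^2$. *)
Lemma szego_poisson s : szego r (r ^+ 2) s + (r ^+ 2)%:C * (turn r s)^* * (szego r (r ^+ 2) s)^* =
  (1 - r ^+ 4)%:C * (modulus (szego r (r ^+ 2) s) ^+ 2)%:C.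
Proof.
have /andP[a b] := r2_lt1 r_gt r_lt.
have hs := den_neq0 r s a b; have ht := den_neq0 r (- s) a b.
rewrite sqr_modulusC conj_szego conj_turn /szego.
have e : turn r s * turn r (- s) = 1 by rewrite -turnD subrr turn0.
have -> : turn r (- s) = (turn r s)^-1 by rewrite turnNV.
rewrite turnNV in ht; have := turn_neq0 r s.
rewrite rmorphB rmorph1 !rmorphXn in hs ht * => ts.
have -> : r%:C ^+ 4 = (r%:C ^+ 2) ^+ 2 by ring.
move: hs ht; set w := r%:C ^+ 2; move: (turn r s) ts => z z0 hs ht.
have ht' : z - w != 0.
  by apply: contraNneq ht => /subr0_eq <-; rewrite divff// subrr.
by field; rewrite hs z0 ht'.
Qed.

(* The Szego kernel K and conj K - 1 are both Gram matrices and add up to the Poisson kernel,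
   which therefore dominates K as a quadratic form, and is absolutely summable. *)
Lemma MTker_adjoint (lam : nat -> R[i]) n : (1 - r) * n%:R <= 3 / 4 ->
  \sum_(0 <= j < n) modulus (\sum_(0 <= k < n) lam k * MTker k%:R j) ^+ 2 <=
  972 / (1 - r) * \sum_(0 <= k < n) modulus (lam k) ^+ 2.
Proof.
have [rg rl] := (r_gt, r_lt).
move=> nr.
(* The conjugation turns the Gram form of $K$ into that of $\overline K$, and the twist supplies the
   factor [(turn r s)^*] of [szego_poisson]. Thus [r ^+ 2 * X'] is the nonnegative form of
   $\overline K-1$. *)
pose mu k := (lam k * turn r (- k%:R))^*.
set X := \sum_(0 <= j < n) _.
set X' := \sum_(0 <= j < n) modulus (\sum_(0 <= k < n) mu k * MTker k%:R j) ^+ 2.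
have X'0 : 0 <= X' by apply: sumr_ge0 => *; exact: sqr_ge0.
pose P k l : R := (1 - r ^+ 4) * modulus (szego r (r ^+ 2) (k%:R - l%:R)) ^+ 2.
have H : (X + r ^+ 2 * X')%:C = \sum_(0 <= k < n) \sum_(0 <= l < n) lam k * (lam l)^* * (P k l)%:C.
  have e' : X'%:C = \sum_(0 <= k < n) \sum_(0 <= l < n)
      lam k * turn r (- k%:R) * (lam l * turn r (- l%:R))^* * (szego r (r ^+ 2) (k%:R - l%:R))^*.
    rewrite -[LHS]conjR MTker_adjoint_gram rmorph_sum /=; apply: eq_bigr => k _.
    rewrite rmorph_sum /=; apply: eq_bigr => l _.
    rewrite /mu (conjM _ (szego _ _ _)) (conjM ((_ * _)^*)) !conjCK.
    by [].
  rewrite rmorphD rmorphM /= e' MTker_adjoint_gram mulr_sumr -big_split/=.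
  apply: eq_bigr => k _; rewrite mulr_sumr -big_split/=; apply: eq_bigr => l _.
  have -> : (P k l)%:C = (1 - r ^+ 4)%:C * (modulus (szego r (r ^+ 2) (k%:R - l%:R)) ^+ 2)%:C.
    exact: rmorphM.
  rewrite -szego_poisson (conjM (lam l)) !conj_turn opprB opprK.
  rewrite (turnD r l%:R); ring.
have H2 : X <= \sum_(0 <= k < n) \sum_(0 <= l < n) modulus (lam k) * modulus (lam l) * P k l.
  apply: (@le_trans _ _ (X + r ^+ 2 * X')).
    by rewrite lerDl mulr_ge0// sqr_ge0.
  apply: (le_trans (ler_norm _)); rewrite -modulusR H.
  apply: (le_trans (modulus_sum _ _ _)); apply: ler_sum => k _.
  apply: (le_trans (modulus_sum _ _ _)); apply: ler_sum => l _.
  rewrite !modulusM modulusJ modulusR ger0_norm// /P.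
  by rewrite mulr_ge0 ?sqr_ge0// subr_ge0 exprn_ile1//; lra.
apply: (le_trans H2).
(* $324=4\cdot 9^2$, from $1-r^4\le 4(1-r)$ and [modulus_szego]. *)
have HP k l : (k < n)%N -> (l < n)%N -> P k l <= 324 / (1 - r) * avg_ker 1 k l.
  move=> kn ln; rewrite /P /avg_ker.
  have kl : `|k%:R - l%:R| <= n%:R :> R.
    have : k%:R <= n%:R :> R by rewrite ler_nat ltnW.
    have : l%:R <= n%:R :> R by rewrite ler_nat ltnW.
    have : 0 <= k%:R :> R by []. have : 0 <= l%:R :> R by [].
    by rewrite ler_norml => *; apply/andP; split; lra.
  have h : modulus (szego r (r ^+ 2) (k%:R - l%:R)) <= 9 / ((1 - r) * (1 + `|k%:R - l%:R|)).
    apply: (modulus_szego rg rl); [exact: lexx|nra|nra].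
  move: h kl; set x := `|_|; set S := modulus _ => h kl.
  have x0 : 0 <= x by exact: normr_ge0.
  have S0 : 0 <= S by exact: modulus_ge0.
  have d0 : 0 < (1 - r) * (1 + x) by apply: mulr_gt0; lra.
  have h2 : S ^+ 2 <= (9 / ((1 - r) * (1 + x))) ^+ 2.
    by rewrite ler_pXn2r ?nnegrE ?divr_ge0// ltW.
  have r4 : 1 - r ^+ 4 <= 4 * (1 - r).
    have -> : 1 - r ^+ 4 = (1 - r) * (1 + r + r ^+ 2 + r ^+ 3) by ring.
    rewrite mulrC ler_wpM2r//; first lra.
    have : r ^+ 3 <= 1 by apply: exprn_ile1; lra.
    have : r ^+ 2 <= 1 by apply: exprn_ile1; lra.
    lra.
  have := ler_pM _ (sqr_ge0 S) r4 h2.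
  have -> : 4 * (1 - r) * (9 / ((1 - r) * (1 + x))) ^+ 2 = 324 / (1 - r) * (1 / (1 + x) ^+ 2).
    by field; lra.
  by apply; rewrite subr_ge0 exprn_ile1//; lra.
rewrite !big_mkord.
(* Schur's test for a symmetric kernel: $ab\le(a^2+b^2)/2$ and row sums at most 3, whence
   $972=3\cdot 324$. *)
apply: (@le_trans _ _ (\sum_(k < n) \sum_(l < n) (324 / (1 - r)) *
   (2^-1 * (modulus (lam k) ^+ 2 * avg_ker 1 k l) + 2^-1 * (modulus (lam l) ^+ 2 * avg_ker 1 k l)))).
  apply: ler_sum => k _; rewrite big_mkord; apply: ler_sum => l _.
  have h := HP k l (ltn_ord k) (ltn_ord l).
  have p := mulr_ge0 (modulus_ge0 (lam k)) (modulus_ge0 (lam l)).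
  apply: (le_trans (ler_wpM2l p h)); rewrite mulrCA; apply: ler_wpM2l.
    by apply: divr_ge0; lra.
  rewrite -!mulrDr -mulrDl mulrA; apply: ler_wpM2r; first exact: avg_ker_ge0.
  have := sqr_ge0 (modulus (lam k) - modulus (lam l)); lra.
have -> : 972 / (1 - r) = 324 / (1 - r) * 3 by field; lra.
have B0 : 0 <= 324 / (1 - r) by apply: divr_ge0; lra.
set B := 324 / (1 - r) in B0 *.
under eq_bigr do rewrite -mulr_sumr.
rewrite -[leLHS]mulr_sumr -[leRHS]mulrA; apply: ler_wpM2l => //.
under eq_bigr do rewrite big_split/=.
rewrite big_split/= [X in _ + X]exchange_big/=.
have S k : \sum_(l < n) 2^-1 * (modulus (lam k) ^+ 2 * avg_ker 1 k l) <= 3 / 2 * modulus (lam k) ^+ 2.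
  rewrite -mulr_sumr -[X in _ * X <= _]mulr_sumr.
  have := sum_avg_ker k n (isT : (0 < 1)%N) => h.
  have := ler_wpM2l (sqr_ge0 (modulus (lam k))) (h R); lra.
apply: (@le_trans _ _ (\sum_(k < n) 3 / 2 * modulus (lam k) ^+ 2 +
   \sum_(k < n) 3 / 2 * modulus (lam k) ^+ 2)).
  apply: lerD; apply: ler_sum => k _; first exact: S.
  by under eq_bigr do rewrite avg_kerC; exact: S.
rewrite -!mulr_sumr; lra.
Qed.

(** By duality: the square norm of the image [u] is the pairing of [c] with the adjoint applied to
    [u], which [MTker_adjoint] bounds by that same norm. *)
Lemma MTker_bounded (c : nat -> R[i]) n : (1 - r) * n%:R <= 3 / 4 ->
  \sum_(0 <= k < n) modulus (\sum_(0 <= j < n) MTker k%:R j * c j) ^+ 2 <=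
  972 / (1 - r) * \sum_(0 <= j < n) modulus (c j) ^+ 2.
Proof.
have [rg rl] := (r_gt, r_lt).
move=> nr.
pose u k := \sum_(0 <= j < n) MTker k%:R j * c j.
rewrite -/(u _); set X := \sum_(0 <= k < n) _.
pose T j := \sum_(0 <= k < n) (u k)^* * MTker k%:R j.
have A : \sum_(0 <= j < n) modulus (T j) ^+ 2 <= 972 / (1 - r) * X.
  have := MTker_adjoint (fun k => (u k)^*) nr => /le_trans; apply.
  rewrite le_eqVlt; apply/orP; left; apply/eqP; congr (_ * _).
  by apply: eq_bigr => k _; rewrite modulusJ.
have H1 : X%:C = \sum_(0 <= j < n) c j * T j.
  rewrite rmorph_sum /=; under eq_bigr do rewrite sqr_modulusC mulr_suml.
  rewrite exchange_big/=; apply: eq_bigr => j _.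
  by rewrite /T mulr_sumr; apply: eq_bigr => k _; rewrite (mulrC (MTker _ _)) -mulrA (mulrC (MTker _ _)).
have H2 : X <= \sum_(0 <= j < n) modulus (c j) * modulus (T j).
  apply: (le_trans (ler_norm _)); rewrite -modulusR H1.
  apply: (le_trans (modulus_sum _ _ _)).
  by apply: ler_sum => j _; rewrite modulusM.
set B := 972 / (1 - r) in A *.
have B0 : 0 < B by apply: divr_gt0; lra.
have H3 : \sum_(0 <= j < n) modulus (c j) * modulus (T j) <=
   2^-1 * B * \sum_(0 <= j < n) modulus (c j) ^+ 2 + 2^-1 * B^-1 * \sum_(0 <= j < n) modulus (T j) ^+ 2.
  rewrite !mulr_sumr -big_split/=; apply: ler_sum => j _.
  set a := modulus _; set b := modulus _.
  have : 0 <= B^-1 * (B * a - b) ^+ 2 by rewrite mulr_ge0 ?sqr_ge0// invr_ge0 ltW.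
  have -> : B^-1 * (B * a - b) ^+ 2 = B * a ^+ 2 - 2 * (a * b) + B^-1 * b ^+ 2 by field; lra.
  lra.
have H4 : B^-1 * \sum_(0 <= j < n) modulus (T j) ^+ 2 <= X by rewrite mulrC ler_pdivrMr// mulrC.
lra.
Qed.

End gram.

(** * The Toeplitz kernel *)

Section products.
Context {R : realType}.

Lemma prod_1DinvX2 t : \prod_(1 <= s < t.+1) (1 + (s%:R ^+ 2)^-1) <= 4 :> R.
Proof.
(* The induction needs room, so the deficit [4 / u.+2%:R] is carried along; at [u = 0] there is
   equality. *)
suff H u : \prod_(1 <= s < u.+2) (1 + (s%:R ^+ 2)^-1) <= 4 - 4 / u.+2%:R :> R.
  case: t => [|t]; first by rewrite big_nil; lra.
  by apply: (le_trans (H t)); rewrite gerBl divr_ge0.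
elim: u => [|u IH]; first by rewrite big_nat1; lra.
rewrite big_nat_recr//=.
have n0 : 0 <= u%:R :> R by [].
apply: (@le_trans _ _ ((4 - 4 / u.+2%:R) * (1 + (u.+2%:R ^+ 2)^-1))).
  by rewrite ler_wpM2r// addr_ge0// invr_ge0 exprn_ge0.
have -> : u.+3%:R = u%:R + 3 :> R by rewrite -addn3 natrD.
have -> : u.+2%:R = u%:R + 2 :> R by rewrite -addn2 natrD.
set x := u%:R in n0 *.
rewrite -subr_ge0.
have -> : 4 - 4 / (x + 3) - (4 - 4 / (x + 2)) * (1 + ((x + 2) ^+ 2)^-1) =
   4 / ((x + 2) ^+ 3 * (x + 3)) by field; lra.
by rewrite divr_ge0// mulr_ge0 ?exprn_ge0//; lra.
Qed.

Lemma bernoulli_ge (x : R) n : 0 <= x -> 1 + n%:R * x <= (1 + x) ^+ n.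
Proof.
move=> x0; elim: n => [|n IH]; first by rewrite mul0r addr0 expr0.
have -> : n.+1%:R = n%:R + 1 :> R by rewrite natr1.
rewrite exprS.
have n0 : 0 <= n%:R :> R by [].
have p : 0 <= n%:R * x * x by rewrite !mulr_ge0.
have : (1 + x) * (1 + n%:R * x) <= (1 + x) * (1 + x) ^+ n by rewrite ler_wpM2l// addr_ge0.
lra.
Qed.

End products.

Section kap.
Context {R : realType}.
Variable r : R.
Implicit Types (t e n : nat).

Definition Gam t : R[i] := \prod_(0 <= s < t) bet r s.+1%:R.

(** Since $\prod_{i<j}b(m-i)=\Gamma_m/\Gamma_{m-j}$, dividing by [Gam] leaves a kernel depending on
    [m - j] alone. *)
Definition kap t : R[i] := szego r (r ^+ 2) t%:R / Gam t.

(* From prod (1 + 144 / s^2) <= (prod (1 + 1 / s^2))^144 <= 4^144. Numerical constants are locked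
   because unification would otherwise evaluate them. *)
Definition Gam_bound : R := locked (2 ^+ 144).

Hypothesis r_gt : 2^-1 < r.
Hypothesis r_lt : r < 1.

Lemma Gam_bound_ge1 : 1 <= Gam_bound.
Proof. by rewrite /Gam_bound -lock; apply: exprn_ege1; lra. Qed.

Lemma modulus_Gam_le1 t : modulus (Gam t) <= 1.
Proof. by apply: modulus_prod_le1 => s _; exact: modulus_bet_le1. Qed.

Lemma bet_nat_neq0 t : (0 < t)%N -> (1 - r) * t%:R <= 3 / 4 -> bet r t%:R != 0.
Proof. by move=> t0 tr; apply: bet_neq0 => //; rewrite ltr0n. Qed.

Lemma le_range (s t : nat) : (s <= t)%N -> (1 - r) * t%:R <= 3 / 4 -> (1 - r) * s%:R <= 3 / 4.
Proof.
have [rg rl] := (r_gt, r_lt).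
move=> st; apply: le_trans; rewrite ler_wpM2l ?ler_nat//; lra.
Qed.

Lemma GamS t : Gam t.+1 = Gam t * bet r t.+1%:R.
Proof. by rewrite /Gam big_nat_recr. Qed.

Lemma Gam_neq0 t : (1 - r) * t%:R <= 3 / 4 -> Gam t != 0.
Proof.
elim: t => [|t IH] tr; first by rewrite /Gam big_nil oner_neq0.
by rewrite GamS mulf_neq0 ?bet_nat_neq0// IH// (le_range (leqnSn t)).
Qed.

Lemma modulus_GamV t : (1 - r) * t%:R <= 3 / 4 -> modulus (Gam t)^-1 <= Gam_bound.
Proof.
move=> tr.
have G0 := Gam_bound_ge1.
rewrite -(@ler_pXn2r _ 2)// ?nnegrE ?modulus_ge0//; last lra.
apply: (@le_trans _ _ ((\prod_(1 <= s < t.+1) (1 + (s%:R ^+ 2)^-1)) ^+ 144)).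
  rewrite modulusV exprVn /Gam modulus_prod -prodrXl -prodfV -prodrXl big_add1/= big_nat [leRHS]big_nat.
  apply: ler_prod => s /andP[_ st]; rewrite invr_ge0 exprn_ge0 ?modulus_ge0//=.
  have sr := le_range st tr.
  have s0 : 0 < s.+1%:R :> R by rewrite ltr0n.
  have h := sqr_modulus_bet_ge r_gt r_lt s0 sr.
  have b0 : 0 < 1 + 144 / s.+1%:R ^+ 2 :> R.
    by apply: ltr_pwDl; [exact: ltr01|apply: divr_ge0; [exact: ler0n|exact: sqr_ge0]].
  apply: le_trans (bernoulli_ge 144 _); last by rewrite invr_ge0 exprn_ge0.
  by rewrite -[leRHS]invrK lef_pV2// posrE ?invr_gt0// (lt_le_trans _ h)// invr_gt0.
have p0 : 0 <= \prod_(1 <= s < t.+1) (1 + (s%:R ^+ 2)^-1) :> R.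
  by apply: prodr_ge0 => s _; rewrite addr_ge0// invr_ge0 exprn_ge0.
rewrite /Gam_bound -lock -exprM mulnC exprM ler_pXn2r ?nnegrE//.
apply: (le_trans (prod_1DinvX2 _)); lra.
Qed.

Lemma GamD t e : Gam (t + e) = Gam t * \prod_(0 <= i < e) bet r (t + i).+1%:R.
Proof.
elim: e => [|e IH]; first by rewrite addn0 big_nil mulr1.
by rewrite addnS GamS IH big_nat_recr//= mulrA.
Qed.

Lemma kap_telescope t : (1 - r) * t.+1%:R <= 3 / 4 ->
  (1 - r ^+ 2)%:C * kap t.+1 = (Gam t.+1)^-1 - r%:C * (Gam t)^-1.
Proof.
move=> tr; have G1 := Gam_neq0 tr; have G0 := Gam_neq0 (le_range (leqnSn t) tr).
have b0 := bet_nat_neq0 (ltn0Sn t) tr.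
rewrite /kap mulrA szego_bet// GamS.
by field; rewrite b0 G0.
Qed.

Lemma sum_kap T : (1 - r) * T%:R <= 3 / 4 ->
  (1 - r ^+ 2)%:C * \sum_(0 <= t < T.+1) kap t =
  (Gam T)^-1 + (1 - r)%:C * \sum_(0 <= t < T) (Gam t)^-1.
Proof.
elim: T => [_|T IH Tr].
  rewrite big_nat1 big_nil mulr0 addr0 /kap mulrA szego_bet// bet0 mulr0 subr0.
  by rewrite /Gam big_nil div1r.
rewrite big_nat_recr//= mulrDr IH ?(le_range (leqnSn T) Tr)// kap_telescope//.
rewrite [in RHS]big_nat_recr//= mulrDr rmorphB rmorph1; ring.
Qed.

(** The telescoping is imperfect, with weight [r] instead of 1. The remainder is [1 - r] times a sum
    of fewer than $1/(1-r)$ bounded terms. *)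
Lemma modulus_sum_kap T : (1 - r) * T%:R <= 3 / 4 ->
  modulus (\sum_(0 <= t < T) kap t) <= 2 * Gam_bound / (1 - r).
Proof.
have [rg rl] := (r_gt, r_lt); have G1 := Gam_bound_ge1.
case: T => [_|T Tr].
  by rewrite big_nil modulus0; apply: divr_ge0; lra.
have Tr' := le_range (leqnSn T) Tr.
have := congr1 (@modulus R) (sum_kap Tr').
rewrite modulusM modulusR; set S := modulus _ => e.
have : modulus ((Gam T)^-1 + (1 - r)%:C * \sum_(0 <= t < T) (Gam t)^-1) <= 2 * Gam_bound.
  apply: (le_trans (modulusD _ _)).
  have -> : 2 * Gam_bound = Gam_bound + Gam_bound by ring.
  apply: lerD; first exact: modulus_GamV.
  rewrite modulusM modulusR ger0_norm; last lra.
  apply: (@le_trans _ _ ((1 - r) * \sum_(0 <= t < T) Gam_bound)).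
    rewrite ler_wpM2l//; first lra.
    apply: (le_trans (modulus_sum _ _ _)); rewrite big_nat [leRHS]big_nat.
    apply: ler_sum => t /andP[_ tT]; apply: modulus_GamV.
    exact: le_range (ltnW tT) Tr'.
  rewrite sumr_const_nat subn0 -[_ *+ T]mulr_natr mulrCA ler_piMr//; lra.
rewrite -e => h.
rewrite ler_pdivlMr; last lra.
apply: le_trans h; rewrite mulrC ler_wpM2r ?modulus_ge0//.
rewrite ger0_norm; nra.
Qed.

(** The regularity condition of a Calderon-Zygmund kernel. *)
Lemma kapB t e : (1 - r) * (t + e)%:R <= 3 / 4 ->
  modulus (kap (t + e) - kap t) <= 810 * Gam_bound * e%:R / ((1 - r) * (1 + t%:R) ^+ 2).
Proof.
have [rg rl] := (r_gt, r_lt); have G1 := Gam_bound_ge1.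
move=> tr; have tr' := le_range (leq_addr e t) tr.
have [Gte Gt] := (Gam_neq0 tr, Gam_neq0 tr').
have t0 : 0 <= t%:R :> R by [].
have e0 : 0 <= e%:R :> R by [].
have teE : (t + e)%:R = t%:R + e%:R :> R by rewrite natrD.
have d0 : 0 < (1 - r) * (1 + t%:R) by apply: mulr_gt0; lra.
have sz s : (s <= t + e)%N -> modulus (szego r (r ^+ 2) s%:R) <= 9 / ((1 - r) * (1 + s%:R)).
  move=> ste; have := @modulus_szego R r rg rl (r ^+ 2) s%:R (lexx _).
  rewrite ger0_norm//; apply => //; [nra|exact: le_range tr].
have sz' : modulus (szego r (r ^+ 2) (t + e)%:R) <= 9 / ((1 - r) * (1 + t%:R)).
  apply: (le_trans (sz _ (leqnn _))); apply: ler_wpM2l; first lra.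
  rewrite lef_pV2 ?posrE//; last by apply: mulr_gt0; [lra|rewrite teE; lra].
  by rewrite ler_wpM2l; rewrite ?teE; lra.
pose P := \prod_(0 <= i < e) bet r (t + i).+1%:R.
(* First the numerator moves, then the denominator, with constants $8\cdot 9\cdot 9=648$ and $9\cdot
   18=162$, which sum to 810. *)
have -> : kap (t + e) - kap t =
    (szego r (r ^+ 2) (t + e)%:R - szego r (r ^+ 2) t%:R) * (Gam t)^-1 +
    szego r (r ^+ 2) (t + e)%:R * ((Gam (t + e))^-1 * (1 - P)).
  rewrite /kap; have : Gam (t + e) = Gam t * P by exact: GamD.
  move: Gte; set G := Gam (t + e) => Gte E.
  have P0 : P != 0 by apply: contraNneq Gte; rewrite E => ->; rewrite mulr0.
  by rewrite E; field; rewrite P0 Gt.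
have hP : modulus (1 - P) <= 18 * e%:R / (1 + t%:R).
  have -> : 1 - P = \prod_(0 <= i < e) (1 : R[i]) - P by rewrite big1_eq.
  apply: (le_trans (modulus_prodB _ _)) => [i _|i _|].
  - by rewrite modulus1.
  - exact: modulus_bet_le1.
  apply: (@le_trans _ _ (\sum_(0 <= i < e) 18 / (1 + t%:R))).
    rewrite big_nat [leRHS]big_nat; apply: ler_sum => i /andP[_ ie].
    have ti : (1 - r) * (t + i).+1%:R <= 3 / 4.
      by apply: le_range tr; rewrite -addnS leq_add2l.
    apply: (le_trans (modulus_1Bbet rg rl _ ti)) => //.
    apply: ler_wpM2l; first lra.
    have p (k : nat) : 0 < 1 + k%:R :> R by rewrite ltr_pwDl.
    rewrite lef_pV2 ?posrE; [|exact: p|exact: p].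
    by rewrite lerD2l ler_nat ltnW// ltnS leq_addr.
  rewrite sumr_const_nat subn0 -[_ *+ e]mulr_natr; lra.
have hS : modulus (szego r (r ^+ 2) (t + e)%:R - szego r (r ^+ 2) t%:R) <=
    648 * e%:R / ((1 - r) * (1 + t%:R) ^+ 2).
  have /andP[a b] := r2_lt1 rg rl.
  rewrite szegoB//; [|by apply/andP|by apply/andP].
  rewrite !modulusM.
  have h1 := @turn_dist R r rg rl (r ^+ 2) (r ^+ 2) (t + e)%:R t%:R a (ltW b).
  rewrite subrr normr0 add0r teE (addrC t%:R) addrK ger0_norm// in h1.
  rewrite (addrC e%:R) -teE in h1.
  have -> : 648 * e%:R / ((1 - r) * (1 + t%:R) ^+ 2) =
    8 * (1 - r) * e%:R * (9 / ((1 - r) * (1 + t%:R))) * (9 / ((1 - r) * (1 + t%:R))) by field; lra.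
  apply: ler_pM; rewrite ?mulr_ge0 ?modulus_ge0//; last by apply: sz; exact: leq_addr.
  by apply: ler_pM; rewrite ?modulus_ge0.
apply: (le_trans (modulusD _ _)); rewrite !modulusM.
have -> : 810 * Gam_bound * e%:R / ((1 - r) * (1 + t%:R) ^+ 2) =
   648 * e%:R / ((1 - r) * (1 + t%:R) ^+ 2) * Gam_bound +
   9 / ((1 - r) * (1 + t%:R)) * (Gam_bound * (18 * e%:R / (1 + t%:R))) by field; lra.
apply: lerD; apply: ler_pM; rewrite ?mulr_ge0 ?modulus_ge0 ?modulus_GamV//.
by apply: ler_pM; rewrite ?modulus_ge0 ?modulus_GamV.
Qed.

End kap.

(** * Cotlar's inequality *)

Lemma sum_nat_sub (R : numDomainType) (F : nat -> R) (a b M : nat) :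
  (forall i, 0 <= F i) -> (b <= M)%N -> \sum_(a <= i < b) F i <= \sum_(i < M) F i.
Proof.
move=> F0 bM; rewrite -(big_mkord xpredT F).
have [ab|ba] := leqP b a; first by rewrite (big_geq ab); exact: sumr_ge0.
rewrite (big_cat_nat (leq0n a) (leq_trans (ltnW ba) bM))/=.
rewrite (big_cat_nat (ltnW ba) bM)/= addrCA lerDl.
by apply: addr_ge0; apply: sumr_ge0.
Qed.

Lemma modulus_nat (R : realType) (n : nat) : modulus (n%:R : R[i]) = n%:R.
Proof.
have -> : (n%:R : R[i]) = (n%:R : R)%:C by rewrite rmorph_nat.
by rewrite modulusR ger0_norm.
Qed.

(** $3256=16+3240$: the columns that meet the averaging window and those that do not, in
    [toep_trunc_bound]. *)
Definition far_bound (R : realType) : R := locked (3256 * Gam_bound).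

Lemma far_bound_ge72 (R : realType) : 72 <= far_bound R.
Proof. by have := @Gam_bound_ge1 R; rewrite /far_bound -lock; lra. Qed.

Section cotlar.
Context {R : realType}.
Variable r : R.
Variable c : nat -> R[i].
Implicit Types (j k l n m d t M : nat).

(* The Toeplitz part of the lower triangular matrix [MTker]. *)
Definition toep k : R[i] := \sum_(0 <= j < k.+1) kap r (k - j) * c j.

Definition toep_trunc n m : R[i] := \sum_(0 <= j < n) kap r (m - j) * c j.

Hypothesis r_gt : 2^-1 < r.
Hypothesis r_lt : r < 1.

Lemma MTker_kap m j : (j <= m)%N -> (1 - r) * m%:R <= 3 / 4 ->
  MTker r m%:R j = (Num.sqrt (1 - r ^+ 2))%:C * (Gam r m * kap r (m - j)).
Proof.
move=> jm mr; rewrite /MTker; congr (_ * _).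
have := GamD r (m - j) j; rewrite subnK// => ->.
have G0 : Gam r (m - j) != 0.
  by apply: Gam_neq0 => //; apply: le_range mr => //; exact: leq_subr.
have -> : \prod_(0 <= i < j) bet r (m%:R - i%:R) = \prod_(0 <= i < j) bet r (m - j + i).+1%:R.
  rewrite big_nat_rev/= add0n big_nat [RHS]big_nat; apply: eq_bigr => i /andP[_ ij].
  by congr bet; rewrite -natrB; [congr (_%:R)|]; lia.
rewrite /kap natrB//; set P := \prod_(_ <= _ < _) _; set Q := szego _ _ _.
by field.
Qed.

Lemma MTker_toep M k : (k < M)%N -> (1 - r) * M%:R <= 3 / 4 ->
  \sum_(0 <= j < M) MTker r k%:R j * c j = (Num.sqrt (1 - r ^+ 2))%:C * (Gam r k * toep k).
Proof.
move=> kM Mr; rewrite (@big_cat_nat _ _ _ k.+1)//=.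
rewrite [X in _ + X]big_nat [X in _ + X]big1 ?addr0; last first.
  by move=> j /andP[kj _]; rewrite /MTker prod_bet0// mul0r mulr0 mul0r.
rewrite /toep !mulr_sumr big_nat [RHS]big_nat; apply: eq_bigr => j /andP[_ jk].
rewrite MTker_kap// ?mulrA//; apply: le_range Mr => //; exact: ltnW.
Qed.

(** Divides [MTker_bounded] by the diagonal factor, whose modulus is at least $\sqrt{1-r}$ over
    [Gam_bound]. *)
Lemma toep_bounded M : (1 - r) * M%:R <= 3 / 4 ->
  \sum_(k < M) modulus (toep k) ^+ 2 <=
  972 * Gam_bound ^+ 2 / (1 - r) ^+ 2 * \sum_(j < M) modulus (c j) ^+ 2.
Proof.
have [rg rl] := (r_gt, r_lt); have G1 := @Gam_bound_ge1 R.
move=> Mr; have := MTker_bounded rg rl c Mr; rewrite !big_mkord => h.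
apply: (@le_trans _ _ (Gam_bound ^+ 2 / (1 - r) *
    \sum_(k < M) modulus (\sum_(0 <= j < M) MTker r k%:R j * c j) ^+ 2)); last first.
  have B0 : 0 <= Gam_bound ^+ 2 / (1 - r).
    by apply: divr_ge0; [exact: sqr_ge0|lra].
  apply: (le_trans (ler_wpM2l B0 h)); rewrite le_eqVlt; apply/orP; left; apply/eqP.
  by field; lra.
rewrite mulr_sumr; apply: ler_sum => k _.
have -> : modulus (\sum_(0 <= j < M) MTker r k%:R j * c j) ^+ 2 =
    (1 - r ^+ 2) * (modulus (Gam r k) ^+ 2 * modulus (toep k) ^+ 2).
  rewrite (MTker_toep (ltn_ord k) Mr) modulusM modulusM modulusR 2!exprMn.
  by rewrite real_normK ?num_real// sqr_sqrtr//; nra.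
have kr : (1 - r) * (k : nat)%:R <= 3 / 4 by apply: le_range Mr => //; exact: ltnW.
have := modulus_GamV rg rl kr; rewrite modulusV => hG.
have g0 : 0 < modulus (Gam r k) by rewrite modulus_gt0 Gam_neq0.
have {}hG : 1 <= Gam_bound * modulus (Gam r k).
  by rewrite -ler_pdivrMr// div1r.
have {}hG : 1 <= Gam_bound ^+ 2 * modulus (Gam r k) ^+ 2.
  by rewrite -exprMn exprn_ege1.
set T := modulus (toep k) ^+ 2; have T0 : 0 <= T by exact: sqr_ge0.
have -> : Gam_bound ^+ 2 / (1 - r) * ((1 - r ^+ 2) * (modulus (Gam r k) ^+ 2 * T)) =
  (Gam_bound ^+ 2 * modulus (Gam r k) ^+ 2) * ((1 + r) * T) by field; lra.
apply: (@le_trans _ _ (1 * ((1 + r) * T))).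
  by rewrite mul1r ler_peMl//; lra.
by apply: ler_wpM2r => //; apply: mulr_ge0 => //; lra.
Qed.

(** Truncated subtraction lets one formula serve both for [j <= m] and for columns that begin inside
    the window. *)
Lemma kap_window m d j : \sum_(0 <= i < d | (j <= m + i)%N) kap r (m + i - j) =
  \sum_(0 <= t < m + d - j) kap r t - \sum_(0 <= t < m - j) kap r t.
Proof.
elim: d => [|d IH]; first by rewrite big_nil addn0 subrr.
rewrite big_mkcond big_nat_recr//= -big_mkcond IH/= addnS.
case: leqP => jmd; last by rewrite addr0; congr (_ - _); congr bigop; congr index_iota; lia.
by rewrite subSn// big_nat_recr//=; ring.
Qed.

Lemma modulus_kap_window m d j : (1 - r) * (m + d)%:R <= 3 / 4 ->
  modulus (\sum_(0 <= i < d | (j <= m + i)%N) kap r (m + i - j)) <= 4 * Gam_bound / (1 - r).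
Proof.
have [rg rl] := (r_gt, r_lt).
move=> h; rewrite kap_window; apply: (le_trans (modulusB _ _)).
have -> : 4 * Gam_bound / (1 - r) = 2 * Gam_bound / (1 - r) + 2 * Gam_bound / (1 - r) by field; lra.
by apply: lerD; apply: modulus_sum_kap => //; apply: le_range h => //; lia.
Qed.

Lemma avg_ker_near d m j : (0 < d)%N -> `|m%:R - j%:R| <= d%:R :> R ->
  d%:R^-1 <= 4 * avg_ker d m j :> R.
Proof.
move=> d0 h; rewrite /avg_ker; have d1 : 0 < d%:R :> R by rewrite ltr0n.
have x0 := normr_ge0 (m%:R - j%:R : R); set x := `|_| in h x0 *.
rewrite mulrA ler_pdivlMr ?exprn_gt0//; last lra.
apply: (@le_trans _ _ (d%:R^-1 * (d%:R + d%:R) ^+ 2)).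
  apply: ler_wpM2l; first by rewrite invr_ge0 ltW.
  by rewrite ler_pXn2r ?nnegrE//; lra.
rewrite le_eqVlt; apply/orP; left; apply/eqP; field; lra.
Qed.

Lemma avg_ker_far d m j : (0 < d)%N -> (j <= m)%N -> (d <= m - j)%N ->
  d%:R / (1 + (m - j)%:R) ^+ 2 <= 4 * avg_ker d m j :> R.
Proof.
move=> d0 jm dmj; rewrite /avg_ker; have d1 : 0 < d%:R :> R by rewrite ltr0n.
have h : d%:R <= (m - j)%:R :> R by rewrite ler_nat.
rewrite natrB// in h *; have -> : `|m%:R - j%:R| = m%:R - j%:R :> R.
  by rewrite ger0_norm// subr_ge0 ler_nat.
set x := m%:R - j%:R in h *.
rewrite mulrCA; apply: ler_wpM2l; first exact: ltW.
have -> : 4 * ((d%:R + x) ^+ 2)^-1 = (((d%:R + x) / 2) ^+ 2)^-1 by field; lra.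
rewrite lef_pV2 ?posrE ?exprn_gt0//; last 2 first; try lra.
by rewrite ler_pXn2r ?nnegrE//; lra.
Qed.

(* Cotlar's argument: average [toep] over a window of length [d] to the right of [m]. The columns
   meeting the window telescope, hence contribute O(1) each, and the remaining ones are nearly
   constant over the window. *)
Lemma toep_truncE n m : (n <= m)%N -> let d := (m - n).+1 in
  d%:R * toep_trunc n m =
  \sum_(0 <= i < d) toep (m + i)
  - \sum_(n <= j < m + d) (\sum_(0 <= i < d | (j <= m + i)%N) kap r (m + i - j)) * c j
  - \sum_(0 <= i < d) \sum_(0 <= j < n) (kap r (m - j + i) - kap r (m - j)) * c j.
Proof.
move=> nm d.
have -> : \sum_(n <= j < m + d) (\sum_(0 <= i < d | (j <= m + i)%N) kap r (m + i - j)) * c j =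
    \sum_(0 <= i < d) \sum_(n <= j < (m + i).+1) kap r (m + i - j) * c j.
  under eq_bigr do rewrite mulr_suml.
  under eq_bigr do rewrite big_mkcond.
  rewrite exchange_big/= big_nat [RHS]big_nat; apply: eq_bigr => i /andP[_ id].
  rewrite -big_mkcond/= [RHS](@big_nat_widen _ _ _ _ _ (m + d)); last by rewrite -addnS leq_add2l.
  by apply: eq_bigl => j; rewrite ltnS.
rewrite -!sumrB.
have -> : d%:R * toep_trunc n m = \sum_(0 <= i < d) toep_trunc n m.
  by rewrite sumr_const_nat subn0 mulr_natl.
apply: eq_big_nat => i /andP[_ id].
rewrite /toep (@big_cat_nat _ _ _ n)//=; last by rewrite ltnW// ltnS (leq_trans nm)// leq_addr.
rewrite addrK -sumrB /toep_trunc; apply: eq_big_nat => j /andP[_ jn].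
have -> : (m + i - j = m - j + i)%N by lia.
by ring.
Qed.

Lemma toep_trunc_bound n m M : (n <= m)%N -> (m + (m - n).+1 <= M)%N -> (1 - r) * M%:R <= 3 / 4 ->
  modulus (toep_trunc n m) <=
  4 * \sum_(k < M) avg_ker (m - n).+1 m k * modulus (toep k) +
  far_bound R / (1 - r) * \sum_(j < M) avg_ker (m - n).+1 m j * modulus (c j).
Proof.
have [rg rl] := (r_gt, r_lt); have G1 := @Gam_bound_ge1 R.
move=> nm; set d := (m - n).+1 => dM Mr.
have d0 : 0 < d%:R :> R by rewrite ltr0n.
have H := toep_truncE nm; cbv zeta in H; rewrite -/d in H.
set S1 := \sum_(k < M) _; set S2 := \sum_(j < M) _.
have B1 : \sum_(0 <= i < d) modulus (toep (m + i)) <= d%:R * (4 * S1).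
  rewrite mulrA mulrC -ler_pdivrMr; last by apply: mulr_gt0; lra.
  apply: (@le_trans _ _ (\sum_(m <= k < m + d) avg_ker d m k * modulus (toep k))); last first.
    by apply: sum_nat_sub => // i; rewrite mulr_ge0 ?avg_ker_ge0 ?modulus_ge0.
  have -> : \sum_(m <= k < m + d) avg_ker d m k * modulus (toep k) =
      \sum_(0 <= i < d) avg_ker d m (m + i) * modulus (toep (m + i)).
    rewrite -[X in \big[_/_]_(X <= _ < _) _](add0n m) big_addn addKn.
    by apply: eq_bigr => i _; rewrite addnC.
  rewrite mulr_suml big_nat [leRHS]big_nat.
  apply: ler_sum => i /andP[_ id].
  rewrite mulrC; apply: ler_wpM2r; first exact: modulus_ge0.
  have h : d%:R^-1 <= 4 * avg_ker d m (m + i) :> R.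
    apply: avg_ker_near => //.
    by rewrite natrD opprD addrA subrr add0r normrN ger0_norm// ler_nat ltnW.
  have -> : (d%:R * 4)^-1 = d%:R^-1 / 4 :> R by field; lra.
  lra.
(* These columns lie within [d] of [m], where [avg_ker] is at least $1/(4d)$; a bounded column sum
   is thus paid for by [d] times the average. *)
have B2 : modulus (\sum_(n <= j < m + d) (\sum_(0 <= i < d | (j <= m + i)%N) kap r (m + i - j)) * c j)
    <= d%:R * (16 * Gam_bound / (1 - r) * S2).
  apply: (le_trans (modulus_sum _ _ _)).
  apply: (@le_trans _ _ (\sum_(n <= j < m + d) d%:R * (16 * Gam_bound / (1 - r) * (avg_ker d m j * modulus (c j))))).
    rewrite big_nat [leRHS]big_nat; apply: ler_sum => j /andP[nj jmd].
    rewrite modulusM mulrA mulrA; apply: ler_wpM2r; first exact: modulus_ge0.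
    have := @modulus_kap_window m d j _ => /(_ _)/le_trans; apply.
      exact: le_range Mr.
    have := @avg_ker_near d m j isT _ => /(_ _) hn.
    have {}hn : d%:R^-1 <= 4 * avg_ker d m j :> R.
      apply: hn; rewrite ler_norml; apply/andP; split.
        have : j%:R <= m%:R + d%:R :> R by rewrite -natrD ler_nat ltnW.
        lra.
      have : m%:R <= j%:R + d%:R :> R by rewrite -natrD ler_nat /d; lia.
      lra.
    have := ler_wpM2l (ltW d0) hn; rewrite divff ?gt_eqF// => {}hn.
    have g0 : 0 <= 4 * Gam_bound / (1 - r) by apply: divr_ge0; lra.
    have := ler_wpM2l g0 hn; lra.
  rewrite -!mulr_sumr; apply: ler_wpM2l; first exact: ltW.
  apply: ler_wpM2l; first by apply: divr_ge0; lra.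
  by apply: sum_nat_sub => // i; rewrite mulr_ge0 ?avg_ker_ge0 ?modulus_ge0.
(* Here [j < n] gives [d <= m - j], so the regularity bound $d/(1+m-j)^2$ is comparable to
   [avg_ker d m j]; $3240=4\cdot 810$. *)
have B3 : modulus (\sum_(0 <= i < d) \sum_(0 <= j < n) (kap r (m - j + i) - kap r (m - j)) * c j)
    <= d%:R * (3240 * Gam_bound / (1 - r) * S2).
  apply: (le_trans (modulus_sum _ _ _)).
  apply: (@le_trans _ _ (\sum_(0 <= i < d) (3240 * Gam_bound / (1 - r) * S2))); last first.
    by rewrite sumr_const_nat subn0 [leRHS]mulr_natl lexx.
  rewrite big_nat [leRHS]big_nat; apply: ler_sum => i /andP[_ id].
  apply: (le_trans (modulus_sum _ _ _)).
  apply: (@le_trans _ _ (\sum_(0 <= j < n) (3240 * Gam_bound / (1 - r) * (avg_ker d m j * modulus (c j))))).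
    rewrite big_nat [leRHS]big_nat; apply: ler_sum => j /andP[_ jn].
    rewrite modulusM mulrA; apply: ler_wpM2r; first exact: modulus_ge0.
    have mji : (1 - r) * (m - j + i)%:R <= 3 / 4 by apply: le_range Mr => //; lia.
    apply: (le_trans (kapB rg rl mji)).
    have jm : (j <= m)%N by lia.
    have dmj : (d <= m - j)%N by rewrite /d; lia.
    have h := @avg_ker_far d m j isT jm dmj.
    have id' : i%:R <= d%:R :> R by rewrite ler_nat ltnW.
    have x0 : 0 < (1 + (m - j)%:R) ^+ 2 :> R by rewrite exprn_gt0// ltr_pwDl.
    set x := (1 + (m - j)%:R) ^+ 2 in h x0 *.
    have -> : 810 * Gam_bound * i%:R / ((1 - r) * x) = 810 * Gam_bound / (1 - r) * (i%:R / x).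
      by field; lra.
    have -> : 3240 * Gam_bound / (1 - r) * avg_ker d m j =
       810 * Gam_bound / (1 - r) * (4 * avg_ker d m j) by field; lra.
    apply: ler_wpM2l; first by apply: divr_ge0; lra.
    apply: le_trans h; apply: ler_wpM2r => //; by rewrite invr_ge0 ltW.
  rewrite -mulr_sumr; apply: ler_wpM2l; first by apply: divr_ge0; lra.
  apply: sum_nat_sub => [k|]; first by rewrite mulr_ge0 ?avg_ker_ge0 ?modulus_ge0.
  by lia.
have := congr1 (@modulus R) H.
rewrite modulusM (modulus_nat R d).
move=> E; rewrite -(ler_pM2l d0) E.
apply: (le_trans (modulusB _ _)); apply: (le_trans (lerD (modulusB _ _) (lexx _))).
have := le_trans (modulus_sum _ _ _) B1 => {}B1.
have -> : d%:R * (4 * S1 + far_bound R / (1 - r) * S2) =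
   d%:R * (4 * S1) + d%:R * (16 * Gam_bound / (1 - r) * S2) + d%:R * (3240 * Gam_bound / (1 - r) * S2).
  by rewrite /far_bound -lock; field; lra.
by apply: lerD => //; apply: lerD.
Qed.

End cotlar.

(** * Partial sums on one arc *)

Lemma leq_window n N : (n <= N)%N -> (n <= (4 * N).+1)%N.
Proof. by lia. Qed.

Lemma window_le n m N : (n <= m)%N -> (m <= 2 * N)%N -> (m + (m - n).+1 <= (4 * N).+1)%N.
Proof. by lia. Qed.

Lemma double_le j n m N : (j <= n)%N -> (n <= N)%N -> (2 * N < m)%N -> (2 * j <= m)%N.
Proof. by lia. Qed.

(** $14580=9\cdot 1458+2\cdot 729$: the error of the product and that of the Szego kernel in
    [MTfun_MTker], where $(u+1)/u\le 2$. *)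
Definition cell_bound (R : realType) : R := locked 14580.

Lemma cell_bound_ge0 (R : realType) : 0 <= cell_bound R.
Proof. by rewrite /cell_bound -lock; lra. Qed.

Section arc.
Context {R : realType}.
Variable r : R.
Implicit Types (c : nat -> R[i]) (j k l n m d t M N : nat) (x y : R).

(** The system on the circle without its signs, with the first zero at position 0 instead of 1; see
    [MT_turn]. *)
Definition MTfun y j : R[i] := (Num.sqrt (1 - r ^+ 2))%:C *
  (\prod_(0 <= i < j) gam r (y - i%:R) * szego r r (y - j%:R)).

Hypothesis r_gt : 2^-1 < r.
Hypothesis r_lt : r < 1.

Local Notation S := (Num.sqrt (1 - r ^+ 2)).

Lemma sqr_sqrt_1Br2 : S ^+ 2 = 1 - r ^+ 2.
Proof. by have /andP[_ b] := r2_lt1 r_gt r_lt; rewrite sqr_sqrtr// subr_ge0 ltW. Qed.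

Lemma telescope_inv m j : (j <= m)%N ->
  \sum_(0 <= i < j) ((m%:R - i%:R) * (m%:R - i%:R + 1))^-1 <= (m%:R - j%:R + 1)^-1 :> R.
Proof.
move=> jm.
suff -> : \sum_(0 <= i < j) ((m%:R - i%:R) * (m%:R - i%:R + 1))^-1 =
   (m%:R - j%:R + 1)^-1 - (m%:R + 1)^-1 :> R by rewrite gerBl invr_ge0.
elim: j jm => [|j IH] jm; first by rewrite big_nil subr0 subrr.
rewrite big_nat_recr//= IH; last exact: ltnW.
have h : j%:R + 1 <= m%:R :> R by rewrite natr1 ler_nat.
have -> : j.+1%:R = j%:R + 1 :> R by rewrite natr1.
have j0 : 0 <= j%:R :> R by [].
by field; lra.
Qed.

Section comparison.
Variables (m : nat) (y : R).
Hypothesis my : m%:R - 1 <= y.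
Hypothesis ym : y <= m%:R.
Hypothesis mr : (1 - r) * m%:R <= 3 / 4.

Lemma dist_cell j : (j < m)%N ->
  [/\ m%:R - j%:R <= 1 + `|y - j%:R|, (1 - r) * `|y - j%:R| <= 3 / 4,
      `|m%:R - j%:R| = m%:R - j%:R :> R & (1 - r) * `|m%:R - j%:R| <= 3 / 4].
Proof.
have [rg rl] := (r_gt, r_lt); have [h1 h2 h3] := And3 my ym mr.
move=> jm; have h : j%:R + 1 <= m%:R :> R by rewrite natr1 ler_nat.
have j0 : 0 <= j%:R :> R by [].
rewrite !ger0_norm; try lra.
by split => //; [lra|nra|nra].
Qed.

Lemma szego_cell j : (j < m)%N ->
  modulus (szego r r (y - j%:R)) <= 9 / ((1 - r) * (m%:R - j%:R)) /\
  modulus (szego r (r ^+ 2) (m%:R - j%:R)) <= 9 / ((1 - r) * (m%:R - j%:R + 1)).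
Proof.
have [rg rl] := (r_gt, r_lt).
move=> jm; have [a b e d] := dist_cell jm.
have h : j%:R + 1 <= m%:R :> R by rewrite natr1 ler_nat.
split.
  apply: le_trans (modulus_szego rg rl _ (lexx r) b) _; first by nra.
  apply: ler_wpM2l; first lra.
  rewrite lef_pV2 ?posrE; [by apply: ler_wpM2l => //; lra|by apply: mulr_gt0; lra..].
apply: le_trans (modulus_szego rg rl (lexx _) _ d) _; first by nra.
by rewrite e (addrC _ 1).
Qed.

Lemma turn_cell rho i : (rho = 1) \/ (rho = r) -> (i < m)%N ->
  modulus (rho%:C * turn r (y - i%:R) - (rho * r)%:C * turn r (m%:R - i%:R)) <= 9 * (1 - r).
Proof.
have [rg rl] := (r_gt, r_lt); have [h1 h2 h3] := And3 my ym mr.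
move=> rhoE im; have rho01 : 0 <= rho /\ rho <= 1 by case: rhoE => ->; lra.
apply: (le_trans (@turn_dist R r rg rl _ _ _ _ _ _)); [lra|lra|].
have -> : `|rho - rho * r| = rho * (1 - r).
  by rewrite -{1}(mulr1 rho) -mulrBr ger0_norm//; apply: mulr_ge0; lra.
have -> : y - i%:R - (m%:R - i%:R) = - (m%:R - y) by ring.
by rewrite normrN ger0_norm; nra.
Qed.

Lemma gam_bet i : (i < m)%N ->
  modulus (gam r (y - i%:R) - bet r (m%:R - i%:R)) <=
  1458 * ((m%:R - i%:R) * (m%:R - i%:R + 1))^-1.
Proof.
have [rg rl] := (r_gt, r_lt).
move=> im; have [s1 s2] := szego_cell im.
have h : i%:R + 1 <= m%:R :> R by rewrite natr1 ler_nat.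
have /andP[a b] := r_lt1 rg rl; have /andP[a' b'] := r2_lt1 rg rl.
rewrite /gam /bet bfactorB; first last.
- by rewrite rturnE; exact: den_neq0.
- exact: den_neq0.
rewrite modulusN rturnE !modulusM.
have t := turn_cell (or_introl (erefl 1)) im; rewrite rmorph1 !mul1r in t.
rewrite -/(szego r r (y - i%:R)) -/(szego r (r ^+ 2) (m%:R - i%:R)).
set u := m%:R - i%:R in s1 s2 t *.
have u1 : 1 <= u by rewrite /u; lra.
have -> : 1458 * (u * (u + 1))^-1 = 2 * (1 - r) * (9 * (1 - r)) * (9 / ((1 - r) * u)) *
   (9 / ((1 - r) * (u + 1))) by field; lra.
apply: ler_pM => //; rewrite ?mulr_ge0 ?modulus_ge0//.
apply: ler_pM => //; rewrite ?mulr_ge0 ?modulus_ge0//.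
apply: ler_pM => //; rewrite ?mulr_ge0 ?modulus_ge0//.
by rewrite modulusR ger0_norm; nra.
Qed.

(** The sampled system may replace the true one on the cell to the left of [m]. Factors at distance
    $u$ change by $O(1/u^2)$, so their product changes by $O(1/u)$; times the Szego kernel this is
    $O(1/u^2)$, an average at scale 1. *)
Lemma MTfun_MTker j : (j < m)%N ->
  modulus (MTfun y j - MTker r m%:R j) <= S * (cell_bound R / (1 - r) * avg_ker 1 m j).
Proof.
have [rg rl] := (r_gt, r_lt).
move=> jm; have [s1 s2] := szego_cell jm; have [_ _ e _] := dist_cell jm.
have h : j%:R + 1 <= m%:R :> R by rewrite natr1 ler_nat.
have /andP[a b] := r_lt1 rg rl; have /andP[a' b'] := r2_lt1 rg rl.
rewrite /MTfun /MTker -mulrBr modulusM modulusR ger0_norm ?sqrtr_ge0//.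
apply: ler_wpM2l; first exact: sqrtr_ge0.
set p := \prod_(_ <= _ < _) _; set p' := \prod_(_ <= _ < _) _.
set q := szego r r _ in s1 *; set q' := szego _ _ _ in s2 *.
have -> : p * q - p' * q' = (p - p') * q' + p * (q - q') by ring.
have hp : modulus (p - p') <= 1458 * (m%:R - j%:R + 1)^-1.
  apply: (le_trans (modulus_prodB _ _)) => [i _|i _|].
  - by rewrite modulus_gam.
  - exact: modulus_bet_le1.
  apply: (@le_trans _ _ (\sum_(0 <= i < j) 1458 * ((m%:R - i%:R) * (m%:R - i%:R + 1))^-1)).
    rewrite big_nat [leRHS]big_nat; apply: ler_sum => i /andP[_ ij].
    by apply: gam_bet; exact: ltn_trans jm.
  rewrite -mulr_sumr; apply: ler_wpM2l; first lra.
  exact/telescope_inv/ltnW.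
have p1 : modulus p <= 1.
  by apply: modulus_prod_le1 => i _; rewrite modulus_gam.
have hq : modulus (q - q') <= 9 * (1 - r) * (9 / ((1 - r) * (m%:R - j%:R))) *
    (9 / ((1 - r) * (m%:R - j%:R + 1))).
  rewrite /q /q' szegoB//; [|by apply/andP|by apply/andP].
  rewrite !modulusM; apply: ler_pM => //; rewrite ?mulr_ge0 ?modulus_ge0//.
  apply: ler_pM => //; rewrite ?mulr_ge0 ?modulus_ge0//.
  have := turn_cell (or_intror (erefl r)) jm; by rewrite -expr2.
apply: (le_trans (modulusD _ _)); rewrite !modulusM.
rewrite /avg_ker /cell_bound -lock e; set u := m%:R - j%:R in s1 s2 hp hq *.
have u1 : 1 <= u by rewrite /u; lra.
apply: (@le_trans _ _ (1458 * (u + 1)^-1 * (9 / ((1 - r) * (u + 1))) +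
    1 * (9 * (1 - r) * (9 / ((1 - r) * u)) * (9 / ((1 - r) * (u + 1)))))).
  by apply: lerD; apply: ler_pM; rewrite ?modulus_ge0.
rewrite -subr_ge0.
have -> : 14580 / (1 - r) * (1%:R / (1%:R + u) ^+ 2) -
  (1458 * (u + 1)^-1 * (9 / ((1 - r) * (u + 1))) +
   1 * (9 * (1 - r) * (9 / ((1 - r) * u)) * (9 / ((1 - r) * (u + 1))))) =
  729 * (u - 1) / ((1 - r) * (u * (1 + u) ^+ 2)) by field; lra.
apply: divr_ge0; first by apply: mulr_ge0; lra.
by apply: mulr_ge0; [lra|apply: mulr_ge0; [lra|exact: sqr_ge0]].
Qed.

End comparison.

Definition cotlar_max c M d m : R :=
  4 * (\sum_(k < M) avg_ker d m k * modulus (toep r c k)) +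
  far_bound R / (1 - r) * (\sum_(j < M) avg_ker d m j * modulus (c j)).

Lemma avg_sum_ge0 (f : nat -> R[i]) d m M :
  0 <= \sum_(k < M) avg_ker d m k * modulus (f k).
Proof. by apply: sumr_ge0 => k _; rewrite mulr_ge0 ?avg_ker_ge0 ?modulus_ge0. Qed.

(** The truncation [n] survives only through the width [d], which has finitely many possible
    values. *)
Lemma partial_left_bound c N n m y : m%:R - 1 <= y -> y <= m%:R -> (1 - r) * m%:R <= 3 / 4 ->
  (1 - r) * (4 * N).+1%:R <= 3 / 4 -> (n <= N)%N -> (n <= m)%N ->
  exists2 d, (0 < d <= m.+1)%N &
  modulus (\sum_(0 <= j < n) c j * MTfun y j) <=
  S * (cell_bound R / (1 - r) * (\sum_(j < (4 * N).+1) avg_ker 1 m j * modulus (c j)) +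
       cotlar_max c (4 * N).+1 d m).
Proof.
have [rg rl] := (r_gt, r_lt); have G1 := far_bound_ge72 R; have B1 := cell_bound_ge0 R.
move=> my ym mr Nr nN nm; pose M := (4 * N).+1; rewrite -/M in Nr *.
have d0 : 0 <= 1 - r by rewrite subr_ge0 ltW.
have b0 : 0 <= cell_bound R / (1 - r) * (\sum_(j < M) avg_ker 1 m j * modulus (c j)).
  by apply: mulr_ge0; [exact: divr_ge0|exact: avg_sum_ge0].
have nM : (n <= M)%N by exact: leq_window.
have g0 : 0 <= far_bound R / (1 - r) by apply: divr_ge0 => //; apply: le_trans G1.
(* For [m <= 2 * N] the averaging window fits below [(4 * N).+1]. Beyond, all indices satisfy
   [2 * j <= m], and absolute values suffice with width [m]. *)
have [mN|mN] := leqP m (2 * N).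
  exists (m - n).+1; first by rewrite /= ltnS leq_subr.
  have -> : \sum_(0 <= j < n) c j * MTfun y j =
      \sum_(0 <= j < n) c j * (MTfun y j - MTker r m%:R j) +
      S%:C * (Gam r m * toep_trunc r c n m).
    rewrite /toep_trunc !mulr_sumr -big_split/=; apply: eq_big_nat => j /andP[_ jn].
    rewrite (MTker_kap rg rl (leq_trans (ltnW jn) nm) mr); ring.
  apply: (le_trans (modulusD _ _)); rewrite mulrDr; apply: lerD.
    apply: (le_trans (modulus_sum _ _ _)).
    apply: (@le_trans _ _ (\sum_(0 <= j < n) S * (cell_bound R / (1 - r) * (avg_ker 1 m j * modulus (c j))))).
      rewrite big_nat [leRHS]big_nat; apply: ler_sum => j /andP[_ jn].
      have h := MTfun_MTker my ym mr (leq_trans jn nm).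
      by rewrite modulusM mulrC; have := ler_wpM2r (modulus_ge0 (c j)) h; rewrite !mulrA.
    rewrite -mulr_sumr; apply: ler_wpM2l; first exact: sqrtr_ge0.
    rewrite -mulr_sumr; apply: ler_wpM2l; first exact: divr_ge0.
    by apply: sum_nat_sub => // i; rewrite mulr_ge0 ?avg_ker_ge0 ?modulus_ge0.
  rewrite !modulusM modulusR ger0_norm ?sqrtr_ge0//.
  apply: ler_wpM2l; first exact: sqrtr_ge0.
  apply: (@le_trans _ _ (1 * modulus (toep_trunc r c n m))).
    by apply: ler_wpM2r; [exact: modulus_ge0|exact: modulus_Gam_le1].
  rewrite mul1r; apply: toep_trunc_bound => //.
  exact: window_le.
have m0 : (0 < m)%N by exact: leq_ltn_trans mN.
exists m; first by rewrite m0 leqnSn.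
have h1 : 0 <= \sum_(k < M) avg_ker m m k * modulus (toep r c k) by exact: avg_sum_ge0.
have h2 : 0 <= \sum_(j < M) avg_ker m m j * modulus (c j) by exact: avg_sum_ge0.
apply: (@le_trans _ _ (S * (far_bound R / (1 - r) * \sum_(j < M) avg_ker m m j * modulus (c j)))); last first.
  apply: ler_wpM2l; first exact: sqrtr_ge0.
  rewrite /cotlar_max addrA lerDr addr_ge0//.
  by rewrite mulr_ge0.
apply: (le_trans (modulus_sum _ _ _)).
apply: (@le_trans _ _ (\sum_(0 <= j < n) S * (far_bound R / (1 - r) * (avg_ker m m j * modulus (c j))))); last first.
  rewrite -mulr_sumr; apply: ler_wpM2l; first exact: sqrtr_ge0.
  rewrite -mulr_sumr; apply: ler_wpM2l => //.
  by apply: sum_nat_sub => // i; rewrite mulr_ge0 ?avg_ker_ge0 ?modulus_ge0.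
rewrite big_nat [leRHS]big_nat; apply: ler_sum => j /andP[_ jn].
suff h : modulus (MTfun y j) <= S * (far_bound R / (1 - r) * avg_ker m m j).
  by rewrite modulusM mulrC; have := ler_wpM2r (modulus_ge0 (c j)) h; rewrite !mulrA.
have jm : (j < m)%N by exact: leq_trans jn nm.
have [s1 _] := szego_cell my ym mr jm.
have [_ _ e _] := dist_cell my ym mr jm.
rewrite /MTfun !modulusM modulusR ger0_norm ?sqrtr_ge0// -!mulrA.
apply: ler_wpM2l; first exact: sqrtr_ge0.
have p1 : modulus (\prod_(0 <= i < j) gam r (y - i%:R)) <= 1.
  by apply: modulus_prod_le1 => i _; rewrite modulus_gam.
apply: (le_trans (ler_wpM2r (modulus_ge0 _) p1)); rewrite mul1r; apply: (le_trans s1).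
rewrite /avg_ker e.
have jm2 : 2 * j%:R <= m%:R :> R by rewrite -natrM ler_nat (double_le _ nN mN)// ltnW.
have j0 : 0 <= j%:R :> R by [].
have m1 : 1 <= m%:R :> R by rewrite ler1n.
set u := j%:R in jm2 j0 *; set v := m%:R in jm2 m1 *.
(* With $v-u\ge v/2$, the kernel of width $v$ is at least $1/(4v)\ge 1/(8(v-u))$, hence $72=8\cdot
   9$. *)
apply: (@le_trans _ _ (72 / (1 - r) * (v / (v + (v - u)) ^+ 2))).
  rewrite -subr_ge0.
  have -> : 72 / (1 - r) * (v / (v + (v - u)) ^+ 2) - 9 / ((1 - r) * (v - u)) =
    9 * (8 * v * (v - u) - (v + (v - u)) ^+ 2) / ((1 - r) * ((v - u) * (v + (v - u)) ^+ 2)).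
    by field; lra.
  apply: divr_ge0; first by nra.
  by apply: mulr_ge0; [lra|apply: mulr_ge0; [lra|exact: sqr_ge0]].
rewrite mulrA.
apply: ler_wpM2r; first by apply: divr_ge0 => //; exact: sqr_ge0.
by apply: ler_wpM2r => //; rewrite invr_ge0.
Qed.

End arc.

(** $3456=6\cdot 576$, where 6 combines the square of a sum of three terms with $1-r^2\le 2(1-r)$;
    $15552=16\cdot 972$ comes from the term with [toep]. *)
Definition left_bound (R : realType) : R :=
  locked (3456 * (cell_bound R ^+ 2 + 15552 * Gam_bound ^+ 2 + far_bound R ^+ 2)).

Lemma left_bound_ge0 (R : realType) : 0 <= left_bound R.
Proof.
rewrite /left_bound -lock; apply: mulr_ge0; first by lra.
apply: addr_ge0; last exact: sqr_ge0.
by apply: addr_ge0; [exact: sqr_ge0|apply: mulr_ge0; [lra|exact: sqr_ge0]].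
Qed.

Lemma sqr_sum3_le (R : realDomainType) (a b c : R) :
  (a + b + c) ^+ 2 <= 3 * (a ^+ 2 + b ^+ 2 + c ^+ 2).
Proof. by have := sqr_ge0 (a - b); have := sqr_ge0 (b - c); have := sqr_ge0 (a - c); lra. Qed.

Lemma sum_reflect (V : zmodType) (F : nat -> V) (p N : nat) : (p <= N)%N ->
  \sum_(p <= j < N) F j = \sum_(0 <= j < N - p) F (N.-1 - j)%N.
Proof.
move=> pN; rewrite [RHS]big_nat_rev/= add0n.
rewrite -[in LHS](add0n p) big_addn big_nat [RHS]big_nat.
by apply: eq_bigr => i /andP[_ iN]; congr F; lia.
Qed.

Lemma prod_reflect (A : comNzRingType) (F : nat -> A) (p N : nat) : (p <= N)%N ->
  \prod_(p <= j < N) F j = \prod_(0 <= j < N - p) F (N.-1 - j)%N.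
Proof.
move=> pN; rewrite [RHS]big_nat_rev/= add0n.
rewrite -[in LHS](add0n p) big_addn big_nat [RHS]big_nat.
by apply: eq_bigr => i /andP[_ iN]; congr F; lia.
Qed.

(** * Maximal bounds for beginnings of sums and, by reflection, for their tails *)

Section arc.
Context {R : realType}.
Variable r : R.
Implicit Types (c : nat -> R[i]) (j k l n m d t M N T : nat) (x y : R).

Hypothesis r_gt : 2^-1 < r.
Hypothesis r_lt : r < 1.

Local Notation S := (Num.sqrt (1 - r ^+ 2)).

(** A single number per cell dominates all truncations at all points of the cell: the width is
    chosen as the worst one, and the maximal theorem then applies. *)
Lemma partial_left_square c N T : (1 - r) * (4 * N).+1%:R <= 3 / 4 ->
  exists e : nat -> R, [/\ forall m, 0 <= e m,
    \sum_(m < T) e m ^+ 2 <= left_bound R / (1 - r) * \sum_(j < (4 * N).+1) modulus (c j) ^+ 2 &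
    forall m y n, (m < T)%N -> m%:R - 1 <= y -> y <= m%:R -> (1 - r) * m%:R <= 3 / 4 ->
      (n <= N)%N -> (n <= m)%N -> modulus (\sum_(0 <= j < n) c j * MTfun r y j) <= e m].
Proof.
have [rg rl] := (r_gt, r_lt).
move=> Nr; case: T => [|T].
  exists (fun=> 0); split => //; rewrite big_ord0; apply: mulr_ge0.
    by apply: divr_ge0; [exact: left_bound_ge0|rewrite subr_ge0 ltW].
  by apply: sumr_ge0 => *; exact: sqr_ge0.
have [d [d0 dmax]] := exists_argmax (cotlar_max r c (4 * N).+1) (ltn0Sn T).
move: Nr dmax; move: (4 * N).+1 (fun m y n => @partial_left_bound R r r_gt r_lt c N n m y) => M left Mr dmax.
pose A1 m := \sum_(j < M) avg_ker 1 m j * modulus (c j).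
pose A2 m := \sum_(j < M) avg_ker (d m) m j * modulus (toep r c j).
pose A3 m := \sum_(j < M) avg_ker (d m) m j * modulus (c j).
exists (fun m => S * (cell_bound R / (1 - r) * A1 m + cotlar_max r c M (d m) m)).
have d1 : 0 < 1 - r by rewrite subr_gt0.
have f0 : 0 <= far_bound R by apply: le_trans (far_bound_ge72 R).
have S0 : 0 <= S by exact: sqrtr_ge0.
split.
- move=> m; apply: mulr_ge0 => //; apply: addr_ge0.
    by apply: mulr_ge0; [apply: divr_ge0; [exact: cell_bound_ge0|exact: ltW]|exact: avg_sum_ge0].
  apply: addr_ge0; first by apply: mulr_ge0 => //; exact: avg_sum_ge0.
  by apply: mulr_ge0; [apply: divr_ge0 => //; exact: ltW|exact: avg_sum_ge0].
- set X := \sum_(j < M) modulus (c j) ^+ 2.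
  have X0 : 0 <= X by apply: sumr_ge0 => *; exact: sqr_ge0.
  have h1 : \sum_(m < T.+1) A1 m ^+ 2 <= 576 * X.
    by apply: (avg_ker_maximal T.+1 M (d := fun=> 1%N) (g := fun j => modulus (c j))) => // j; exact: modulus_ge0.
  have h3 : \sum_(m < T.+1) A3 m ^+ 2 <= 576 * X.
    by apply: (avg_ker_maximal T.+1 M (d := d) (g := fun j => modulus (c j))) => // j; exact: modulus_ge0.
  have h2 : \sum_(m < T.+1) A2 m ^+ 2 <= 576 * (972 * Gam_bound ^+ 2 / (1 - r) ^+ 2 * X).
    apply: le_trans (avg_ker_maximal T.+1 M (d := d) (g := fun j => modulus (toep r c j)) _ _) _ => //.
      by move=> j; exact: modulus_ge0.
    by apply: ler_wpM2l; [lra|exact: toep_bounded].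
  apply: (@le_trans _ _ (\sum_(m < T.+1) (6 * (1 - r)) * ((cell_bound R / (1 - r)) ^+ 2 * A1 m ^+ 2 +
      16 * A2 m ^+ 2 + (far_bound R / (1 - r)) ^+ 2 * A3 m ^+ 2))).
    apply: ler_sum => m _; rewrite exprMn sqr_sqrt_1Br2//.
    rewrite /cotlar_max addrA -/(A1 m) -/(A2 m) -/(A3 m).
    have -> : (cell_bound R / (1 - r)) ^+ 2 * A1 m ^+ 2 + 16 * A2 m ^+ 2 +
        (far_bound R / (1 - r)) ^+ 2 * A3 m ^+ 2 =
      (cell_bound R / (1 - r) * A1 m) ^+ 2 + (4 * A2 m) ^+ 2 + (far_bound R / (1 - r) * A3 m) ^+ 2.
      by rewrite !exprMn; congr (_ + _ + _); congr (_ * _); ring.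
    set a := cell_bound R / (1 - r) * A1 m; set b := 4 * A2 m; set e := far_bound R / (1 - r) * A3 m.
    apply: (le_trans (ler_wpM2l _ (sqr_sum3_le a b e))); first by nra.
    set q := a ^+ 2 + b ^+ 2 + e ^+ 2.
    have q0 : 0 <= q by rewrite !addr_ge0 ?sqr_ge0.
    by rewrite mulrA; apply: ler_wpM2r => //; nra.
  rewrite -mulr_sumr !big_split/= -!mulr_sumr.
  have -> : left_bound R / (1 - r) * X = (6 * (1 - r)) *
     ((cell_bound R / (1 - r)) ^+ 2 * (576 * X) +
      16 * (576 * (972 * Gam_bound ^+ 2 / (1 - r) ^+ 2 * X)) +
      (far_bound R / (1 - r)) ^+ 2 * (576 * X)).
    rewrite /left_bound -lock; field; lra.
  apply: ler_wpM2l; first by apply: mulr_ge0; [lra|exact: ltW].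
  apply: lerD; first apply: lerD.
  - by apply: ler_wpM2l => //; exact: sqr_ge0.
  - by apply: ler_wpM2l => //; lra.
  - by apply: ler_wpM2l => //; exact: sqr_ge0.
- move=> m y n mT my ym mr nN nm.
  have [k /andP[k0 km] /le_trans] := left m y n my ym mr Mr nN nm; apply.
  apply: ler_wpM2l => //; rewrite lerD2l; apply: dmax.
  by rewrite k0 (leq_trans km).
Qed.

Lemma szego_reflect y : szego r r y = - (gam r y * turn r (- y) * szego r r (- y)).
Proof.
have /andP[a b] := r_lt1 r_gt r_lt.
have h := den_neq0 r y a b; have h' := den_neq0 r (- y) a b.
have z0 := turn_neq0 r y.
rewrite /szego /gam /bfactor turnNV in h' *.
have h2 : turn r y - r%:C != 0.
  by apply: contraNneq h' => /subr0_eq <-; rewrite divff// subrr.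
move: (turn r y) h h' z0 h2 => z h h' z0 h2.
by field; rewrite h z0 h2.
Qed.

Lemma gamN y : gam r y * gam r (- y) = 1.
Proof.
have /andP[a b] := r_lt1 r_gt r_lt.
have h := den_neq0 r y a b; have h' := den_neq0 r (- y) a b.
have z0 := turn_neq0 r y.
rewrite /gam /bfactor turnNV in h' *.
have h2 : turn r y - r%:C != 0.
  by apply: contraNneq h' => /subr0_eq <-; rewrite divff// subrr.
move: (turn r y) h h' z0 h2 => z h h' z0 h2.
by field; rewrite h z0 h2.
Qed.

(* On the circle, the tail functions are, up to a common unimodular factor, those of the
   sequence read backwards. *)
Lemma MTfun_reflect N y j : (j < N)%N ->
  MTfun r y j = - (\prod_(0 <= i < N) gam r (y - i%:R)) *
   (turn r (N.-1%:R - y - (N.-1 - j)%:R) * MTfun r (N.-1%:R - y) (N.-1 - j)).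
Proof.
move=> jN; rewrite /MTfun.
have Nj : (N.-1 - j)%:R = N.-1%:R - j%:R :> R.
  by rewrite natrB//; lia.
have -> : N.-1%:R - y - (N.-1 - j)%:R = - (y - j%:R) :> R by rewrite Nj; ring.
rewrite (szego_reflect (y - j%:R)).
rewrite (big_cat_nat (leq0n j) (ltnW jN))/= (big_ltn jN)/=.
rewrite (prod_reflect _ jN).
have -> : (N - j.+1 = N.-1 - j)%N by lia.
set A := \prod_(0 <= i < N.-1 - j) gam r (y - (N.-1 - i)%:R).
set B := \prod_(0 <= i < N.-1 - j) gam r (N.-1%:R - y - i%:R).
have AB : A * B = 1.
  rewrite -big_split/= big_nat big1// => i /andP[_ iN].
  have -> : N.-1%:R - y - i%:R = - (y - (N.-1 - i)%:R) :> R.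
    by rewrite natrB; [ring|lia].
  exact: gamN.
rewrite -[LHS]mulr1 -AB; ring.
Qed.

(** Reflection leaves a factor [turn] depending on the index. Replacing it by 1 cancels the
    singularity of the Szego kernel, so the error has no factor $1/(1-r)$. *)
Lemma szego_turn_err y : modulus ((1 - turn r y) * szego r r y) <= 2.
Proof.
have [rg rl] := (r_gt, r_lt).
have /andP[a b] := r_lt1 r_gt r_lt.
have h := den_neq0 r y a b.
rewrite modulusM modulusV ler_pdivrMr ?modulus_gt0//.
have -> : 1 - turn r y = (1 - r%:C * turn r y) - (1 - r)%:C * turn r y.
  by rewrite rmorphB rmorph1; ring.
apply: (le_trans (modulusB _ _)); rewrite modulusM modulus_turn mulr1 modulusR ger0_norm; last lra.
have := modulus_den_ge r y a; lra.
Qed.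

Lemma partial_right_bound c N p y : (p <= N)%N ->
  modulus (\sum_(p <= j < N) c j * MTfun r y j) <=
  modulus (\sum_(0 <= j < N - p) c (N.-1 - j)%N * MTfun r (N.-1%:R - y) j) +
  2 * S * \sum_(0 <= j < N) modulus (c j).
Proof.
move=> pN; set z := N.-1%:R - y.
have -> : \sum_(p <= j < N) c j * MTfun r y j = - (\prod_(0 <= i < N) gam r (y - i%:R)) *
   \sum_(0 <= j < N - p) c (N.-1 - j)%N * (turn r (z - j%:R) * MTfun r z j).
  rewrite sum_reflect// mulr_sumr; apply: eq_big_nat => j /andP[_ jN].
  rewrite (@MTfun_reflect N y); last by lia.
  have -> : (N.-1 - (N.-1 - j) = j)%N by lia.
  by rewrite mulrCA.
rewrite modulusM modulusN modulus_prod big1 ?mul1r; last by move=> *; exact: modulus_gam.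
have -> : \sum_(0 <= j < N - p) c (N.-1 - j)%N * (turn r (z - j%:R) * MTfun r z j) =
  \sum_(0 <= j < N - p) c (N.-1 - j)%N * MTfun r z j -
  \sum_(0 <= j < N - p) c (N.-1 - j)%N * ((1 - turn r (z - j%:R)) * MTfun r z j).
  by rewrite -sumrB; apply: eq_bigr => j _; ring.
apply: (le_trans (modulusB _ _)); rewrite lerD2l.
apply: (le_trans (modulus_sum _ _ _)).
have -> : \sum_(0 <= j < N) modulus (c j) = \sum_(0 <= j < N) modulus (c (N.-1 - j)%N).
  by rewrite sum_reflect// subn0.
apply: (@le_trans _ _ (\sum_(0 <= j < N - p) 2 * S * modulus (c (N.-1 - j)%N))); last first.
  rewrite -mulr_sumr; apply: ler_wpM2l; first by rewrite mulr_ge0// sqrtr_ge0.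
  rewrite [leRHS]big_mkord; apply: sum_nat_sub; last exact: leq_subr.
  by move=> i; exact: modulus_ge0.
apply: ler_sum => j _.
rewrite modulusM mulrC; apply: ler_wpM2r; first exact: modulus_ge0.
rewrite /MTfun; set pr := \prod_(_ <= _ < _) _.
have -> : (1 - turn r (z - j%:R)) * (S%:C * (pr * szego r r (z - j%:R))) =
  pr * (S%:C * ((1 - turn r (z - j%:R)) * szego r r (z - j%:R))) by ring.
rewrite modulusM modulus_prod big1 ?mul1r; last by move=> *; exact: modulus_gam.
rewrite modulusM modulusR ger0_norm ?sqrtr_ge0// mulrC.
by apply: ler_wpM2r; [exact: sqrtr_ge0|exact: szego_turn_err].
Qed.

End arc.

Lemma sum_shift_le (R : numDomainType) (f : nat -> R) (A B : nat) : (forall m, 0 <= f m) ->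
  \sum_(i < A) (if (B <= i)%N then f (i - B)%N else 0) <= \sum_(m < A - B) f m.
Proof.
move=> f0; rewrite -(big_mkord xpredT (fun i => if (B <= i)%N then f (i - B)%N else 0)) -big_mkcond/=.
rewrite -(big_mkord xpredT f).
have -> : \sum_(0 <= i < A | (B <= i)%N) f (i - B)%N = \sum_(B <= i < A) f (i - B)%N.
  by rewrite [RHS](big_nat_widenl _ 0%N).
rewrite -{1}(add0n B) big_addn; under eq_bigr do rewrite addnK.
exact: lexx.
Qed.

Lemma sum_flip_le (R : numDomainType) (f : nat -> R) (A B : nat) : (forall m, 0 <= f m) ->
  \sum_(i < A) (if (i <= B)%N then f (B - i)%N else 0) <= \sum_(m < B.+1) f m.
Proof.
move=> f0; pose g i := if (i <= B)%N then f (B - i)%N else 0.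
apply: (@le_trans _ _ (\sum_(i < A + B.+1) g i)).
  rewrite -(big_mkord xpredT g); apply: sum_nat_sub; last exact: leq_addr.
  by move=> i; rewrite /g; case: ifP.
rewrite -(big_mkord xpredT g) -(big_mkord xpredT f).
rewrite (big_cat_nat (leq0n B.+1) (leq_addl A B.+1))/=.
rewrite [X in _ + X]big_nat [X in _ + X]big1 ?addr0; last first.
  by move=> i /andP[Bi _]; rewrite /g leqNgt Bi.
rewrite [leRHS]big_nat_rev/= add0n big_nat [leRHS]big_nat; apply: ler_sum => i /andP[_ iB].
by rewrite /g -ltnS iB subSS.
Qed.

Lemma sum_sqr_le (R : realDomainType) (f : nat -> R) (n : nat) :
  (\sum_(0 <= j < n) f j) ^+ 2 <= n%:R * \sum_(j < n) f j ^+ 2.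
Proof.
rewrite big_mkord -(ler_pM2l (ltr0n _ 2)).
have -> : 2 * (\sum_(i < n) f i) ^+ 2 = \sum_(i < n) \sum_(j < n) 2 * (f i * f j).
  rewrite expr2 mulr_suml mulr_sumr; apply: eq_bigr => i _.
  by rewrite mulr_sumr mulr_sumr.
have -> : 2 * (n%:R * \sum_(j < n) f j ^+ 2) = \sum_(i < n) \sum_(j < n) (f i ^+ 2 + f j ^+ 2).
  under [RHS]eq_bigr do rewrite big_split/= sumr_const card_ord -mulr_natl.
  rewrite big_split/= -mulr_sumr sumr_const card_ord -mulr_natl.
  by ring.
apply: ler_sum => i _; apply: ler_sum => j _.
have := sqr_ge0 (f i - f j); lra.
Qed.

Lemma pred_sub_lt N j : (0 < N)%N -> (N.-1 - j < N)%N.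
Proof. by lia. Qed.

Lemma sub_le_flip N R0 i p : (i <= p + R0)%N -> (N - p <= N + R0 - i)%N.
Proof. by lia. Qed.

Lemma cell_sub_lt N R0 i : (i < (2 * R0).+1)%N -> (i - R0 < (N + R0).+1)%N.
Proof. by lia. Qed.

Lemma cells_sub_le N R0 : ((2 * R0).+1 - R0 <= (N + R0).+1)%N.
Proof. by lia. Qed.

Lemma cell_le_add R0 i n : (i - R0 < n)%N -> (i <= n + R0)%N.
Proof. by lia. Qed.

(** $15=3(1+4)$ is the weight of the left bound in the square of [u + 2 * v + err]; 80 covers the 60
    from [err] and the 66 of [arc_maximal_single]. *)
Definition arc_bound (R : realType) : R := 15 * left_bound R + 80.

Section arc.
Context {R : realType}.
Variable r : R.
Implicit Types (c : nat -> R[i]) (i j k l n m d t M N T : nat) (x y : R).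

Hypothesis r_gt : 2^-1 < r.
Hypothesis r_lt : r < 1.

Local Notation S := (Num.sqrt (1 - r ^+ 2)).

(** When the spacing is not small an arc holds one point, and the uniform bound of the Szego kernel
    suffices: there are at most 33 cells. *)
Lemma arc_maximal_single c R0 : 8^-1 <= 1 - r -> (1 - r) * R0%:R <= 2 ->
  exists e : nat -> R, [/\ forall i, 0 <= e i,
    \sum_(i < (2 * R0).+1) e i ^+ 2 <= arc_bound R / (1 - r) * \sum_(j < 1) modulus (c j) ^+ 2 &
    forall i y n, (n <= 1)%N -> modulus (\sum_(0 <= j < n) c j * MTfun r y j) <= e i].
Proof.
have [rg rl] := (r_gt, r_lt).
move=> d8 dR0; exists (fun=> modulus (c 0%N) * (S * (1 - r)^-1)); split.
- by move=> _; rewrite !mulr_ge0 ?modulus_ge0 ?sqrtr_ge0// invr_ge0; lra.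
- rewrite big_ord1 sumr_const card_ord -[_ *+ _]mulr_natl !exprMn sqr_sqrt_1Br2//.
  set X := modulus _ ^+ 2; have X0 : 0 <= X by exact: sqr_ge0.
  have -> : (2 * R0).+1%:R * (X * ((1 - r ^+ 2) * (1 - r)^-1 ^+ 2)) =
    (2 * R0).+1%:R * ((1 - r ^+ 2) * (1 - r)^-1 ^+ 2) * X by ring.
  apply: ler_wpM2r => //.
  have -> : (2 * R0).+1%:R = 2 * R0%:R + 1 :> R by rewrite -natr1 natrM.
  have d0 : 0 < 1 - r by lra.
  rewrite ler_pdivlMr//.
  have -> : (2 * R0%:R + 1) * ((1 - r ^+ 2) * (1 - r)^-1 ^+ 2) * (1 - r) =
    (1 + r) * (2 * R0%:R + 1) by field; lra.
  have := left_bound_ge0 R; rewrite /arc_bound => L0.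
  have R00 : 0 <= R0%:R :> R by [].
  have : R0%:R <= 16 :> R by nra.
  nra.
- move=> _ y [|[|//]] _.
    by rewrite big_nil modulus0 !mulr_ge0 ?modulus_ge0 ?sqrtr_ge0// invr_ge0; lra.
  rewrite big_nat1 modulusM; apply: ler_wpM2l; first exact: modulus_ge0.
  rewrite /MTfun big_nil mul1r modulusM modulusR ger0_norm ?sqrtr_ge0//.
  by apply: ler_wpM2l; [exact: sqrtr_ge0|apply: modulus_szego_le => //; lra].
Qed.

Lemma arc_maximal c N R0 : (0 < N)%N -> 1 - r <= 8^-1 -> (1 - r) * N%:R <= 8^-1 ->
  (1 - r) * R0%:R <= 2 ->
  exists e : nat -> R, [/\ forall i, 0 <= e i,
    \sum_(i < (2 * R0).+1) e i ^+ 2 <= arc_bound R / (1 - r) * \sum_(j < N) modulus (c j) ^+ 2 &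
    forall i y n, (i < (2 * R0).+1)%N -> i%:R - R0%:R - 1 <= y -> y <= i%:R - R0%:R ->
      (1 - r) * `|y| <= 2^-1 -> (n <= N)%N ->
      modulus (\sum_(0 <= j < n) c j * MTfun r y j) <= e i].
Proof.
have [rg rl] := (r_gt, r_lt).
move=> N0 d8 dN dR0.
(* The left bounds sum over [(4 * N).+1] indices, so both the coefficients and their reversal are
   extended by zero. *)
pose c1 j := if (j < N)%N then c j else 0.
pose c2 j := if (j < N)%N then c (N.-1 - j)%N else 0.
have Nr : (1 - r) * (4 * N).+1%:R <= 3 / 4.
  have -> : (4 * N).+1%:R = 4 * N%:R + 1 :> R by rewrite -natr1 natrM.
  lra.
pose T := (N + R0).+1.
have [eU [eU0 eUs eUb]] := partial_left_square rg rl c1 T Nr.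
have [eV [eV0 eVs eVb]] := partial_left_square rg rl c2 T Nr.
set X := \sum_(j < N) modulus (c j) ^+ 2.
have X0 : 0 <= X by apply: sumr_ge0 => *; exact: sqr_ge0.
have trunc (f : nat -> R[i]) : \sum_(j < (4 * N).+1) modulus (if (j < N)%N then f j else 0) ^+ 2 =
    \sum_(j < N) modulus (f j) ^+ 2.
  rewrite -(big_mkord xpredT (fun j => modulus (if (j < N)%N then f j else 0) ^+ 2)).
  have N4 : (N <= (4 * N).+1)%N by exact: leq_window.
  rewrite (big_cat_nat (leq0n N) N4)/= [X in _ + X]big_nat [X in _ + X]big1 ?addr0; last first.
    by move=> j /andP[Nj _]; rewrite ifN ?modulus0 ?expr0n// -leqNgt.
  by rewrite big_mkord; apply: eq_bigr => j _; rewrite ltn_ord.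
have eX : \sum_(j < (4 * N).+1) modulus (c1 j) ^+ 2 = X by exact: trunc.
have eX2 : \sum_(j < (4 * N).+1) modulus (c2 j) ^+ 2 = X.
  rewrite [LHS](trunc (fun j => c (N.-1 - j)%N)) /X -(big_mkord xpredT (fun j => modulus (c (N.-1 - j)%N) ^+ 2)).
  by rewrite -(big_mkord xpredT (fun j => modulus (c j) ^+ 2)) [RHS]sum_reflect// subn0.
rewrite eX in eUs; rewrite eX2 in eVs.
pose err := 4 * S * \sum_(0 <= j < N) modulus (c j).
have err0 : 0 <= err.
  by rewrite /err !mulr_ge0 ?sqrtr_ge0// sumr_ge0// => *; exact: modulus_ge0.
pose u i := if (R0 <= i)%N then eU (i - R0)%N else 0.
pose v i := if (i <= N + R0)%N then eV (N + R0 - i)%N else 0.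
have u0 i : 0 <= u i by rewrite /u; case: ifP.
have v0 i : 0 <= v i by rewrite /v; case: ifP.
(* Any partial sum is made of at most one beginning that stops at the cell and two tails, whose
   reflection errors are [err / 2] each. *)
exists (fun i => u i + 2 * v i + err); split.
- by move=> i; rewrite !addr_ge0// mulr_ge0.
- have su : \sum_(i < (2 * R0).+1) u i ^+ 2 <= left_bound R / (1 - r) * X.
    apply: le_trans eUs.
    have -> : \sum_(i < (2 * R0).+1) u i ^+ 2 =
        \sum_(i < (2 * R0).+1) (if (R0 <= i)%N then (fun m => eU m ^+ 2) (i - R0)%N else 0).
      by apply: eq_bigr => i _; rewrite /u; case: ifP => // _; rewrite expr0n.
    apply: le_trans (@sum_shift_le _ (fun m => eU m ^+ 2) _ _ _) _; first by move=> m; exact: sqr_ge0.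
    rewrite -(big_mkord xpredT (fun m => eU m ^+ 2)); apply: sum_nat_sub; last exact: cells_sub_le.
    by move=> i; exact: sqr_ge0.
  have sv : \sum_(i < (2 * R0).+1) v i ^+ 2 <= left_bound R / (1 - r) * X.
    apply: le_trans eVs.
    have -> : \sum_(i < (2 * R0).+1) v i ^+ 2 =
        \sum_(i < (2 * R0).+1) (if (i <= N + R0)%N then (fun m => eV m ^+ 2) (N + R0 - i)%N else 0).
      by apply: eq_bigr => i _; rewrite /v; case: ifP => // _; rewrite expr0n.
    by apply: (@sum_flip_le _ (fun m => eV m ^+ 2)) => m; exact: sqr_ge0.
  apply: (@le_trans _ _ (\sum_(i < (2 * R0).+1) 3 * (u i ^+ 2 + 4 * v i ^+ 2 + err ^+ 2))).
    by apply: ler_sum => i _; apply: (le_trans (sqr_sum3_le _ _ _)); rewrite exprMn; lra.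
  rewrite -mulr_sumr !big_split/= -mulr_sumr sumr_const card_ord -[err ^+ 2 *+ _]mulr_natl.
  have -> : (2 * R0).+1%:R = 2 * R0%:R + 1 :> R by rewrite -natr1 natrM.
  (* The crude $\ell^1$ error is affordable: $N(1-r)\le 1/8$ absorbs the loss in Cauchy-Schwarz, and
     there are at most $5/(1-r)$ cells. *)
  have he : (2 * R0%:R + 1) * err ^+ 2 <= 20 / (1 - r) * X.
    rewrite /err !exprMn sqr_sqrt_1Br2//.
    have := sum_sqr_le (fun j => modulus (c j)) N; rewrite -/X.
    set Y := (\sum_(0 <= j < N) _) ^+ 2 => hY.
    have Y0 : 0 <= Y by exact: sqr_ge0.
    have R00 : 0 <= R0%:R :> R by [].
    have N00 : 0 <= N%:R :> R by [].
    have d0 : 0 < 1 - r by lra.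
    rewrite [leRHS]mulrAC ler_pdivlMr//.
    have a1 : (1 - r) * (2 * R0%:R + 1) <= 5 by lra.
    have a2 : (1 - r ^+ 2) * Y <= 2 * (8^-1 * X).
      have : (1 - r ^+ 2) * Y <= (2 * (1 - r)) * (N%:R * X).
        by apply: ler_pM => //; nra.
      have : (1 - r) * N%:R * X <= 8^-1 * X by rewrite ler_wpM2r.
      lra.
    have a3 : 0 <= (1 - r ^+ 2) * Y by rewrite mulr_ge0//; nra.
    have -> : (2 * R0%:R + 1) * (4 ^+ 2 * (1 - r ^+ 2) * Y) * (1 - r) =
      16 * (((1 - r) * (2 * R0%:R + 1)) * ((1 - r ^+ 2) * Y)) by ring.
    have : ((1 - r) * (2 * R0%:R + 1)) * ((1 - r ^+ 2) * Y) <= 5 * (2 * (8^-1 * X)).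
      apply: ler_pM => //; apply: mulr_ge0; lra.
    lra.
  have : 0 <= (1 - r)^-1 * X by rewrite mulr_ge0// invr_ge0; lra.
  rewrite /arc_bound; lra.
move=> i y n iR y1 y2 yd nN.
have yabs : - `|y| <= y <= `|y| by rewrite -ler_norml.
have [ya yb] := andP yabs.
have c1E k : \sum_(0 <= j < n) c j * MTfun r y j = \sum_(0 <= j < n) c1 j * MTfun r y j.
  by apply: eq_big_nat => j /andP[_ jn]; rewrite /c1 (leq_trans jn nN).
rewrite (c1E 0%N) {c1E}.
have right p : (p <= N)%N -> (i <= p + R0)%N ->
    modulus (\sum_(p <= j < N) c1 j * MTfun r y j) <= v i + 2^-1 * err.
  move=> pN ip; apply: (le_trans (partial_right_bound rg rl c1 y pN)).
  have -> : 2^-1 * err = 2 * S * \sum_(0 <= j < N) modulus (c1 j).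
    have -> : \sum_(0 <= j < N) modulus (c1 j) = \sum_(0 <= j < N) modulus (c j).
      by apply: eq_big_nat => j /andP[_ jN]; rewrite /c1 jN.
    by rewrite /err; field.
  rewrite lerD2r.
  have -> : \sum_(0 <= j < N - p) c1 (N.-1 - j)%N * MTfun r (N.-1%:R - y) j =
      \sum_(0 <= j < N - p) c2 j * MTfun r (N.-1%:R - y) j.
    apply: eq_big_nat => j /andP[_ jNp]; congr (_ * _).
    by rewrite /c1 /c2 pred_sub_lt// (leq_trans jNp (leq_subr _ _)).
  have iN : (i <= N + R0)%N by exact: leq_trans ip (leq_add pN (leqnn R0)).
  rewrite /v iN.
  have N1 : N.-1%:R = N%:R - 1 :> R by rewrite -subn1 natrB.
  have mE : (N + R0 - i)%:R = N%:R + R0%:R - i%:R :> R by rewrite natrB// natrD.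
  apply: eVb; rewrite ?N1 ?mE.
  - by rewrite ltnS leq_subr.
  - lra.
  - lra.
  - have h : N%:R + R0%:R - i%:R <= N%:R + `|y| by lra.
    have := ler_wpM2l (ltW (_ : 0 < 1 - r)) h => /(_ _) h'.
    have := h' ltac:(lra); lra.
  - exact: leq_subr.
  - exact: sub_le_flip.
(* Such a cell lies to the left of the first zero, so the full sum is itself a tail. *)
have [iR0|iR0] := leqP R0 i; last first.
  have -> : \sum_(0 <= j < n) c1 j * MTfun r y j =
      \sum_(0 <= j < N) c1 j * MTfun r y j - \sum_(n <= j < N) c1 j * MTfun r y j.
    by rewrite (big_cat_nat (leq0n n) nN)/= addrK.
  apply: (le_trans (modulusB _ _)).
  have h1 := right 0%N (leq0n N) (ltnW iR0).
  have h2 : modulus (\sum_(n <= j < N) c1 j * MTfun r y j) <= v i + 2^-1 * err.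
    by apply: right => //; rewrite (leq_trans (ltnW iR0))// leq_addl.
  have := u0 i; lra.
have mE : (i - R0)%:R = i%:R - R0%:R :> R by rewrite natrB.
have left m : (m <= N)%N -> (m <= i - R0)%N -> modulus (\sum_(0 <= j < m) c1 j * MTfun r y j) <= u i.
  move=> mN mi; rewrite /u iR0; apply: eUb; rewrite ?mE//.
  - exact: cell_sub_lt.
  - have h : i%:R - R0%:R <= `|y| + 1 by lra.
    have := ler_wpM2l (ltW (_ : 0 < 1 - r)) h => /(_ _) h'.
    have := h' ltac:(lra); lra.
have [ni|ni] := leqP n (i - R0).
  apply: (le_trans (left n nN ni)); have := v0 i; lra.
have mN : (i - R0 <= N)%N by exact: leq_trans (ltnW ni) nN.
(* The truncation lies beyond the cell: the sum is cut at the cell, then completed to [N] and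
   corrected by the tail from [n]. *)
have -> : \sum_(0 <= j < n) c1 j * MTfun r y j =
   \sum_(0 <= j < i - R0) c1 j * MTfun r y j + \sum_(i - R0 <= j < N) c1 j * MTfun r y j
   - \sum_(n <= j < N) c1 j * MTfun r y j.
  by rewrite -(big_cat_nat (leq0n _) mN)/= (big_cat_nat (leq0n n) nN)/= addrK.
apply: (le_trans (modulusB _ _)); apply: (le_trans (lerD (modulusD _ _) (lexx _))).
have h1 := left _ mN (leqnn _).
have h2 : modulus (\sum_(i - R0 <= j < N) c1 j * MTfun r y j) <= v i + 2^-1 * err.
  by apply: right => //; rewrite subnK.
have h3 : modulus (\sum_(n <= j < N) c1 j * MTfun r y j) <= v i + 2^-1 * err.
  by apply: right => //; exact: cell_le_add.
lra.
Qed.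

End arc.

(** * From arcs to the circle *)

Lemma sum_blocks (V : nmodType) (F : nat -> V) (N Q n : nat) : (n <= Q * N)%N ->
  \sum_(0 <= j < n) F j =
  \sum_(0 <= q < Q) \sum_(0 <= j < minn N (n - q * N)) F (q * N + j)%N.
Proof.
elim: Q n => [|Q IH] n; first by rewrite mul0n leqn0 => /eqP ->; rewrite !big_nil.
move=> nQ; rewrite big_nat_recr//=.
have [h|h] := leqP n (Q * N).
  by rewrite (eqP h) minn0 [X in _ + X]big_nil addr0; exact: IH.
rewrite (big_cat_nat (leq0n (Q * N)) (ltnW h))/=; congr (_ + _).
  rewrite IH//; apply: eq_big_nat => q /andP[_ qQ].
  have e : minn N (Q * N - q * N) = N.
    by apply/minn_idPl; rewrite -mulnBl -{1}(mul1n N) leq_mul2r subn_gt0 qQ orbT.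
  have e' : minn N (n - q * N) = N.
    by apply/minn_idPl; apply: leq_trans (leq_sub2r _ (ltnW h)); apply/minn_idPl.
  by rewrite e e'.
rewrite -{1}(add0n (Q * N)%N) big_addn (minn_idPr _); last by rewrite leq_subLR addnC -mulSn.
by apply: eq_bigr => j _; rewrite addnC.
Qed.

Section pointwise.
Context {R : realType}.
Variable r : R.
Implicit Types (c : nat -> R[i]) (i j k l n m d t M N T : nat) (x y : R).

Hypothesis r_gt : 2^-1 < r.
Hypothesis r_lt : r < 1.

Lemma pointsE n : points r n = r%:C * turn r n%:R.
Proof. by rewrite /points /turn; congr (_ * expi _); ring. Qed.

Lemma modulus_points n : modulus (points r n) = r.
Proof.
by rewrite pointsE modulusM modulus_turn mulr1 modulusR ger0_norm//; have := r_gt; lra.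
Qed.

Lemma conj_points_turn n x : (points r n)^* * turn r x = r%:C * turn r (x - n%:R).
Proof. by rewrite pointsE conjM conjR -turnN turnD; ring. Qed.

Lemma blaschke_factor n x :
  (points r n)^* / (modulus (points r n))%:C *
    ((turn r x - points r n) / (1 - (points r n)^* * turn r x)) = - gam r (x - n%:R).
Proof.
have [rg rl] := (r_gt, r_lt).
have /andP[a b] := r_lt1 rg rl.
rewrite modulus_points conj_points_turn /gam /bfactor.
have h := den_neq0 r (x - n%:R) a b.
have r0 : (r%:C : R[i]) != 0 by apply/eqP => -[]; lra.
have e : (points r n)^* * (turn r x - points r n) = r%:C * (turn r (x - n%:R) - r%:C).
  rewrite mulrBr conj_points_turn pointsE conjM conjR -turnN.
  have t : turn r (- n%:R) * turn r n%:R = 1 by rewrite -turnD addNr turn0.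
  have -> : r%:C * turn r (- n%:R) * (r%:C * turn r n%:R) =
    r%:C * r%:C * (turn r (- n%:R) * turn r n%:R) by ring.
  by rewrite t; ring.
rewrite mulrACA e; field; by rewrite h r0.
Qed.

Lemma MT_turn n x : MT (points r) n (turn r x) = (-1) ^+ n * MTfun r (x - 1) n.
Proof.
rewrite /MT /blaschke modulus_points conj_points_turn.
under eq_bigr do rewrite blaschke_factor.
have -> : \prod_(1 <= j < n.+1) - gam r (x - j%:R) = (-1) ^+ n * \prod_(0 <= i < n) gam r (x - 1 - i%:R).
  rewrite big_add1/=.
  elim: n => [|n IH]; first by rewrite !big_nil mulr1.
  rewrite !big_nat_recr//= IH exprS.
  have -> : x - n.+1%:R = x - 1 - n%:R by rewrite -natr1; ring.
  ring.
have -> : x - n.+1%:R = x - 1 - n%:R by rewrite -natr1; ring.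
by rewrite /MTfun /szego; ring.
Qed.

(** The factors of earlier arcs have a unimodular product, so each arc behaves like the first one
    seen from a translated point. *)
Lemma MTfun_shift y s j : MTfun r y (s + j) =
  (\prod_(0 <= i < s) gam r (y - i%:R)) * MTfun r (y - s%:R) j.
Proof.
rewrite /MTfun (big_cat_nat (leq0n s) (leq_addr j s))/=.
have -> : \prod_(s <= i < s + j) gam r (y - i%:R) = \prod_(0 <= i < j) gam r (y - s%:R - i%:R).
  rewrite -{1}(add0n s) big_addn addKn; apply: eq_bigr => i _.
  by congr gam; rewrite natrD; ring.
have -> : y - (s + j)%:R = y - s%:R - j%:R by rewrite natrD; ring.
ring.
Qed.

(** A full turn has length $1/(1-r)$, in general not an integer; the cells therefore do not repeat
    from one turn to the next. *)
Lemma turn_period x l : turn r (x + l%:R / (1 - r)) = turn r x.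
Proof.
have [rg rl] := (r_gt, r_lt).
rewrite /turn -[RHS](expiD2pi _ l); congr expi; field; lra.
Qed.

Lemma MTfun_period y j l : MTfun r (y + l%:R / (1 - r)) j = MTfun r y j.
Proof.
have e z : y + l%:R / (1 - r) - z = (y - z) + l%:R / (1 - r) by ring.
rewrite /MTfun /szego e turn_period; congr (_ * (_ * _)).
by apply: eq_bigr => i _; rewrite /gam e turn_period.
Qed.

Lemma arc_maximal_any : exists N, [/\ (0 < N)%N, (points_length r <= 16 * N)%N,
  (1 - r) * (15 * N%:R) <= 8 & forall c R0, (1 - r) * R0%:R <= 2 ->
  exists e : nat -> R, [/\ forall i, 0 <= e i,
    \sum_(i < (2 * R0).+1) e i ^+ 2 <= arc_bound R / (1 - r) * \sum_(j < N) modulus (c j) ^+ 2 &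
    forall i y n, (i < (2 * R0).+1)%N -> i%:R - R0%:R - 1 <= y -> y <= i%:R - R0%:R ->
      (1 - r) * `|y| <= 2^-1 -> (n <= N)%N ->
      modulus (\sum_(0 <= j < n) c j * MTfun r y j) <= e i]].
Proof.
have [rg rl] := (r_gt, r_lt).
have d0 : 0 < 1 - r by lra.
have hL : (points_length r)%:R <= (1 - r)^-1.
  by rewrite /points_length truncn_le// invr_ge0 ltW.
have [d8|d8] := leP (1 - r) 8^-1; last first.
  exists 1%N; split => //.
  - rewrite muln1 -(ler_nat R); apply: (le_trans hL).
    by rewrite -[leRHS]invrK lef_pV2 ?posrE ?invr_gt0//; lra.
  - by rewrite mulr1; lra.
  move=> c R0 hR0; have [e [e0 es eb]] := arc_maximal_single r_gt r_lt c (ltW d8) hR0.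
  by exists e; split => // i y n _ _ _ _; exact: eb.
(* Arcs of an eighth of a turn, rounded down; since [1 <= X], rounding loses less than a factor 2,
   whence 16 arcs. *)
pose X := (8 * (1 - r))^-1.
have X0 : 0 < X by rewrite invr_gt0 mulr_gt0.
have X1 : 1 <= X by rewrite -[leLHS]invrK lef_pV2 ?posrE ?invr1 ?mulr_gt0//; lra.
have dX : (1 - r) * X = 8^-1 by rewrite /X; field; lra.
have /andP[N1 N2] := truncn_itv (ltW X0).
pose N := Num.truncn X; rewrite -/N in N1 N2.
have N0 : (0 < N)%N by rewrite /N truncn_gt0.
have N0' : 1 <= N%:R :> R by rewrite ler1n.
have dN : (1 - r) * N%:R <= 8^-1 by rewrite -dX ler_wpM2l// ltW.
exists N; split => //.
- rewrite -(ler_nat R); apply: (le_trans hL); rewrite natrM.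
  have -> : (1 - r)^-1 = 8 * X by rewrite /X; field; lra.
  have NS : N.+1%:R = N%:R + 1 :> R by rewrite natr1.
  rewrite NS in N2; lra.
- lra.
by move=> c R0 hR0; apply: arc_maximal.
Qed.

(** Brings the point within half a turn of the start of the arc. The lower limit accounts for
    $\theta\ge-\pi$ (1/2), the shift of origin by one (at most 1/2) and the arc offset (at most
    8). *)
Lemma exists_rep w : - 9 <= (1 - r) * w -> (1 - r) * w <= 2^-1 ->
  exists2 l, (l < 10)%N & (1 - r) * `|w + l%:R / (1 - r)| <= 2^-1.
Proof.
have [rg rl] := (r_gt, r_lt); have d0 : 0 < 1 - r by lra.
move=> w1 w2; have h : 0 <= 2^-1 - (1 - r) * w by lra.
have /andP[a b] := truncn_itv h.
exists (Num.truncn (2^-1 - (1 - r) * w)).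
  rewrite -(ltr_nat R); apply: (le_lt_trans a); lra.
move: a b; set k := Num.truncn _.
have -> : k.+1%:R = k%:R + 1 :> R by rewrite natr1.
set l := k%:R => a b.
rewrite -{1}(ger0_norm (ltW d0)) -normrM.
have -> : (1 - r) * (w + l / (1 - r)) = (1 - r) * w + l by field; lra.
by rewrite ler_norml; apply/andP; split; lra.
Qed.

Lemma exists_cell y R0 : (1 - r)^-1 <= R0%:R -> (1 - r) * `|y| <= 2^-1 ->
  exists2 i, (i < (2 * R0).+1)%N & i%:R - R0%:R - 1 <= y <= i%:R - R0%:R.
Proof.
have [rg rl] := (r_gt, r_lt); have d0 : 0 < 1 - r by lra.
move=> hR hy.
have hy' : `|y| <= (1 - r)^-1 / 2.
  by rewrite mulrC ler_pdivlMr// mulrC.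
have d2 : 2 <= (1 - r)^-1 by rewrite -[leLHS]invrK lef_pV2 ?posrE//; lra.
have yabs : - `|y| <= y <= `|y| by rewrite -ler_norml.
have [ya yb] := andP yabs.
have h : 0 <= y + R0%:R by lra.
have /andP[a b] := truncn_itv h; move: a b; set t := Num.truncn _ => a b.
have tS : t.+1%:R = t%:R + 1 :> R by rewrite natr1.
exists t.+1.
  rewrite ltnS -(ler_nat R) natrM tS; lra.
by rewrite tS in b *; apply/andP; split; lra.
Qed.

(** 16 from Cauchy-Schwarz over the arcs, 10 from repeating each cell for every possible number of
    turns. *)
Definition pointwise_bound : R := 160 * arc_bound R.

(** The majorant is a step function independent of [n], so integrating it only requires the lengths
    of the steps. *)
Lemma maximal_pointwise c : exists (I : finType) (lo e : I -> R), [/\ forall k : I, 0 <= e k,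
  \sum_(k : I) e k <= pointwise_bound / (1 - r) * \sum_(j < points_length r) modulus (c j) ^+ 2 &
  forall theta n, - pi <= theta -> theta <= pi -> (n <= points_length r)%N ->
    modulus (\sum_(0 <= j < n) c j * MT (points r) j (expi theta)) ^+ 2 <=
    \sum_(k : I) (if lo k <= theta <= lo k + 2 * pi * (1 - r) then e k else 0)].
Proof.
have [rg rl] := (r_gt, r_lt); have d0 : 0 < 1 - r by lra.
have [N [N0 NL dN arcs]] := arc_maximal_any.
set L := points_length r in NL *.
pose R0 := L.+1.
have hR0 : (1 - r)^-1 <= R0%:R.
  have i0 : 0 <= (1 - r)^-1 by rewrite invr_ge0 ltW.
  by have /andP[_ /ltW] := truncn_itv i0.
have hL : (1 - r) * L%:R <= 1.
  rewrite mulrC -ler_pdivlMr// div1r /L /points_length truncn_le// invr_ge0; exact: ltW.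
have hR0' : (1 - r) * R0%:R <= 2 by rewrite /R0 -[L.+1%:R]natr1; lra.
(* Absorbs the signs of [MT_turn]; the zeros fill the last arcs, as [16 * N] may exceed [L]. *)
pose ch j := if (j < L)%N then (-1) ^+ j * c j else 0.
have /choice [E HE] : forall q, exists e : nat -> R, [/\ forall i, 0 <= e i,
    \sum_(i < (2 * R0).+1) e i ^+ 2 <=
      arc_bound R / (1 - r) * \sum_(j < N) modulus (ch (q * N + j)%N) ^+ 2 &
    forall i y n, (i < (2 * R0).+1)%N -> i%:R - R0%:R - 1 <= y -> y <= i%:R - R0%:R ->
      (1 - r) * `|y| <= 2^-1 -> (n <= N)%N ->
      modulus (\sum_(0 <= j < n) ch (q * N + j)%N * MTfun r y j) <= e i].
  by move=> q; exact: (arcs (fun j => ch (q * N + j)%N)).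
(* The angle where a cell begins, after undoing the arc offset and the turns; the shift [y = x - 1]
   cancels the [- 1] at the left end of the cell. *)
pose lo (k : 'I_16 * 'I_10 * 'I_(2 * R0).+1) : R :=
  2 * pi * (1 - r) * (k.2%:R - R0%:R + (k.1.1 * N)%:R) - 2 * pi * k.1.2%:R.
pose e (k : 'I_16 * 'I_10 * 'I_(2 * R0).+1) : R := 16 * E k.1.1 k.2 ^+ 2.
have e0 kk : 0 <= e kk by rewrite /e mulr_ge0// sqr_ge0.
exists ('I_16 * 'I_10 * 'I_(2 * R0).+1)%type, lo, e; split => //.
  have -> : \sum_(k : 'I_16 * 'I_10 * 'I_(2 * R0).+1) e k = \sum_(q < 16) \sum_(l < 10) \sum_(i < (2 * R0).+1) 16 * E q i ^+ 2.
    by rewrite [RHS]pair_bigA/= pair_bigA/=; apply: eq_bigr => -[[q l] i] _.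
  have -> : \sum_(q < 16) \sum_(l < 10) \sum_(i < (2 * R0).+1) 16 * E q i ^+ 2 =
     160 * \sum_(q < 16) \sum_(i < (2 * R0).+1) E q i ^+ 2.
    rewrite mulr_sumr; apply: eq_bigr => q _.
    by rewrite sumr_const card_ord -mulr_sumr -mulrnAl -[16 *+ 10]mulr_natl; congr (_ * _); lra.
  have -> : pointwise_bound / (1 - r) * \sum_(j < L) modulus (c j) ^+ 2 =
    160 * (arc_bound R / (1 - r) * \sum_(j < L) modulus (c j) ^+ 2).
    by rewrite /pointwise_bound !mulrA.
  apply: ler_wpM2l; first lra.
  have -> : \sum_(j < L) modulus (c j) ^+ 2 = \sum_(0 <= j < 16 * N) modulus (ch j) ^+ 2.
    rewrite (big_cat_nat (leq0n L) NL)/= [X in _ + X]big_nat [X in _ + X]big1 ?addr0; last first.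
      by move=> j /andP[Lj _]; rewrite /ch ifN ?modulus0 ?expr0n// -leqNgt.
    rewrite big_mkord; apply: eq_bigr => j _.
    by rewrite /ch ltn_ord modulusM modulus_signr mul1r.
  rewrite (@sum_blocks _ _ N 16)// big_mkord mulr_sumr; apply: ler_sum => q _.
  have [_ h _] := HE q; apply: (le_trans h).
  rewrite (minn_idPl _) ?big_mkord//.
  by rewrite -mulnBl -{1}(mul1n N) leq_mul2r subn_gt0 ltn_ord orbT.
move=> theta n th1 th2 nL.
pose x := theta / (2 * pi * (1 - r)).
have p0 : 0 < pi :> R by exact: pi_gt0.
have xE : 2 * pi * (1 - r) * x = theta by rewrite /x; field; lra.
have -> : expi theta = turn r x by rewrite /turn xE.
pose y := x - 1.
have -> : \sum_(0 <= j < n) c j * MT (points r) j (turn r x) = \sum_(0 <= j < n) ch j * MTfun r y j.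
  apply: eq_big_nat => j /andP[_ jn]; rewrite MT_turn /ch (leq_trans jn nL) /y; ring.
rewrite (@sum_blocks _ _ N 16); last exact: leq_trans nL NL.
pose s q := modulus (\sum_(0 <= j < minn N (n - q * N)) ch (q * N + j)%N * MTfun r (y - (q * N)%:R) j).
have s0 q : 0 <= s q by exact: modulus_ge0.
have h1 : modulus (\sum_(0 <= q < 16) \sum_(0 <= j < minn N (n - q * N))
    ch (q * N + j)%N * MTfun r y (q * N + j)) <= \sum_(0 <= q < 16) s q.
  apply: (le_trans (modulus_sum _ _ _)); apply: ler_sum => q _.
  have -> : \sum_(0 <= j < minn N (n - q * N)) ch (q * N + j)%N * MTfun r y (q * N + j) =
    (\prod_(0 <= i < q * N) gam r (y - i%:R)) *
    \sum_(0 <= j < minn N (n - q * N)) ch (q * N + j)%N * MTfun r (y - (q * N)%:R) j.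
    by rewrite mulr_sumr; apply: eq_bigr => j _; rewrite MTfun_shift; ring.
  by rewrite modulusM modulus_prod big1 ?mul1r// => *; exact: modulus_gam.
apply: (@le_trans _ _ ((\sum_(0 <= q < 16) s q) ^+ 2)).
  by rewrite ler_pXn2r ?nnegrE ?modulus_ge0// sumr_ge0.
apply: (le_trans (sum_sqr_le s 16)); rewrite mulr_sumr.
have -> : \sum_(k : 'I_16 * 'I_10 * 'I_(2 * R0).+1) (if lo k <= theta <= lo k + 2 * pi * (1 - r) then e k else 0) =
   \sum_(q < 16) \sum_(l < 10) \sum_(i < (2 * R0).+1)
   (if lo (q, l, i) <= theta <= lo (q, l, i) + 2 * pi * (1 - r) then e (q, l, i) else 0).
  by rewrite [RHS]pair_bigA/= pair_bigA/=; apply: eq_bigr => -[[q l] i] _.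
apply: ler_sum => q _.
pose w := y - (q * N)%:R.
have dx : (1 - r) * x = theta / (2 * pi) by rewrite /x; field; lra.
have t1 : - 2^-1 <= theta / (2 * pi) by rewrite ler_pdivlMr; lra.
have t2 : theta / (2 * pi) <= 2^-1 by rewrite ler_pdivrMr; lra.
have q15 : q%:R <= 15 :> R by rewrite (ler_nat R _ 15) -ltnS.
have qN : (q * N)%:R <= 15 * N%:R :> R by rewrite natrM ler_wpM2r.
have qN0 : 0 <= (q * N)%:R :> R by [].
have w1 : - 9 <= (1 - r) * w.
  have := ler_wpM2l (ltW d0) qN; rewrite /w /y !mulrBr dx; lra.
have w2 : (1 - r) * w <= 2^-1.
  have := mulr_ge0 (ltW d0) qN0; rewrite /w /y !mulrBr dx; lra.
have [l l10 hl] := exists_rep w1 w2.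
have [i iR /andP[i1 i2]] := exists_cell hR0 hl.
have [_ _ hE] := HE q.
have hs : s q <= E q i.
  have -> : s q = modulus (\sum_(0 <= j < minn N (n - q * N)) ch (q * N + j)%N * MTfun r (w + l%:R / (1 - r)) j).
    by congr modulus; apply: eq_bigr => j _; rewrite MTfun_period.
  by apply: hE => //; exact: geq_minl.
rewrite (bigD1 (Ordinal l10))//= (bigD1 (Ordinal iR))//=.
have -> : lo (q, Ordinal l10, Ordinal iR) <= theta <= lo (q, Ordinal l10, Ordinal iR) + 2 * pi * (1 - r).
  have pd : 0 < 2 * pi * (1 - r) by rewrite !mulr_gt0.
  rewrite /lo /= -xE.
  have -> : 2 * pi * l%:R = 2 * pi * (1 - r) * (l%:R / (1 - r)) by field; lra.
  rewrite -mulrBr -[X in _ <= _ <= _ + X]mulr1 -mulrDr !ler_pM2l//.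
  by rewrite /w /y in i1 i2; apply/andP; split; lra.
rewrite -addrA ler_wpDr//; last first.
  rewrite /e /= ler_wpM2l// ler_pXn2r ?nnegrE//; exact: le_trans (s0 q) hs.
apply: addr_ge0; first by apply: sumr_ge0 => k _; case: ifP.
by apply: sumr_ge0 => k _; apply: sumr_ge0 => k' _; case: ifP.
Qed.

End pointwise.

(** * Measurability and integrals *)

Local Open Scope classical_set_scope.
Local Open Scope complex_scope.
Local Open Scope ring_scope.

Section measurability.
Context {R : realType}.
Local Notation T := (measurableTypeR R).
Implicit Types (f g : T -> R[i]).

Definition cmeasurable f : Prop :=
  measurable_fun setT (fun x => complex.Re (f x)) /\
  measurable_fun setT (fun x => complex.Im (f x)).

Lemma cmeasurable_cst (z : R[i]) : cmeasurable (fun=> z).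
Proof. by split; exact: measurable_cst. Qed.

Lemma cmeasurableD f g : cmeasurable f -> cmeasurable g -> cmeasurable (fun x => f x + g x).
Proof.
move=> [f1 f2] [g1 g2]; split.
  have -> : (fun x => complex.Re (f x + g x)) = (fun x => complex.Re (f x) + complex.Re (g x)).
    by apply/funext => x; case: (f x) (g x) => a b [].
  exact: measurable_funD.
have -> : (fun x => complex.Im (f x + g x)) = (fun x => complex.Im (f x) + complex.Im (g x)).
  by apply/funext => x; case: (f x) (g x) => a b [].
exact: measurable_funD.
Qed.

Lemma cmeasurableN f : cmeasurable f -> cmeasurable (fun x => - f x).
Proof.
move=> [f1 f2]; split.
  have -> : (fun x => complex.Re (- f x)) = (fun x => - complex.Re (f x)).
    by apply/funext => x; case: (f x).
  exact: measurable_funN.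
have -> : (fun x => complex.Im (- f x)) = (fun x => - complex.Im (f x)).
  by apply/funext => x; case: (f x).
exact: measurable_funN.
Qed.

Lemma cmeasurable_conj f : cmeasurable f -> cmeasurable (fun x => (f x)^*).
Proof.
move=> [f1 f2]; split.
  by under eq_fun do rewrite conjE.
under eq_fun do rewrite conjE /=.
exact: measurable_funN.
Qed.

Lemma cmeasurableM f g : cmeasurable f -> cmeasurable g -> cmeasurable (fun x => f x * g x).
Proof.
move=> [f1 f2] [g1 g2]; split.
  have -> : (fun x => complex.Re (f x * g x)) = (fun x =>
      complex.Re (f x) * complex.Re (g x) - complex.Im (f x) * complex.Im (g x)).
    by apply/funext => x; case: (f x) (g x) => a b [].
  by apply: measurable_funB; exact: measurable_funM.
have -> : (fun x => complex.Im (f x * g x)) = (fun x =>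
    complex.Re (f x) * complex.Im (g x) + complex.Im (f x) * complex.Re (g x)).
  by apply/funext => x; case: (f x) (g x) => a b [].
by apply: measurable_funD; exact: measurable_funM.
Qed.

Lemma measurable_sqr_modulus f : cmeasurable f -> measurable_fun setT (fun x => modulus (f x) ^+ 2).
Proof.
move=> [f1 f2]; under eq_fun do rewrite sqr_modulus.
by apply: measurable_funD; exact: measurable_funX.
Qed.

Lemma measurable_modulus f : cmeasurable f -> measurable_fun setT (fun x => modulus (f x)).
Proof.
move=> /measurable_sqr_modulus mf.
have -> : (fun x => modulus (f x)) = (@powR R ^~ 2^-1) \o (fun x => modulus (f x) ^+ 2).
  apply/funext => x /=; rewrite powR12_sqrt ?sqr_ge0//.
  by rewrite sqrtr_sqr ger0_norm// modulus_ge0.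
exact: measurableT_comp (measurable_powR _) mf.
Qed.

Lemma cmeasurableV f : cmeasurable f -> cmeasurable (fun x => (f x)^-1).
Proof.
move=> mf; have m2 := measurable_sqr_modulus mf; case: (mf) => f1 f2.
have mi : measurable_fun setT (fun x => (modulus (f x) ^+ 2)^-1).
  have -> : (fun x => (modulus (f x) ^+ 2)^-1) = (@powR R ^~ (-1)) \o (fun x => modulus (f x) ^+ 2).
    by apply/funext => x /=; rewrite powR_inv1// sqr_ge0.
  exact: measurableT_comp (measurable_powR _) m2.
split.
  have -> : (fun x => complex.Re (f x)^-1) = (fun x => complex.Re (f x) * (modulus (f x) ^+ 2)^-1).
    by apply/funext => x; rewrite sqr_modulus; case: (f x).
  exact: measurable_funM.
have -> : (fun x => complex.Im (f x)^-1) = (fun x => - (complex.Im (f x) * (modulus (f x) ^+ 2)^-1)).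
  by apply/funext => x; rewrite sqr_modulus; case: (f x).
by apply: measurable_funN; exact: measurable_funM.
Qed.

Lemma cmeasurable_sum (I : Type) (s : seq I) (F : I -> T -> R[i]) :
  (forall i, cmeasurable (F i)) -> cmeasurable (fun x => \sum_(i <- s) F i x).
Proof.
move=> mF; elim: s => [|i s IH].
  by under eq_fun do rewrite big_nil; exact: cmeasurable_cst.
by under eq_fun do rewrite big_cons; exact: cmeasurableD.
Qed.

Lemma cmeasurable_prod (I : Type) (s : seq I) (F : I -> T -> R[i]) :
  (forall i, cmeasurable (F i)) -> cmeasurable (fun x => \prod_(i <- s) F i x).
Proof.
move=> mF; elim: s => [|i s IH].
  by under eq_fun do rewrite big_nil; exact: cmeasurable_cst.
by under eq_fun do rewrite big_cons; exact: cmeasurableM.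
Qed.

Lemma cmeasurable_expi : cmeasurable (@expi R).
Proof.
by split; apply: continuous_measurable_fun; [exact: continuous_cos|exact: continuous_sin].
Qed.

Lemma cmeasurable_MT (a : nat -> R[i]) (n : nat) : cmeasurable (fun x => MT a n (expi x)).
Proof.
have den j : cmeasurable (fun x : T => (1 - (a j)^* * expi x)^-1).
  apply: cmeasurableV; apply: cmeasurableD; first exact: cmeasurable_cst.
  by apply: cmeasurableN; apply: cmeasurableM; [exact: cmeasurable_cst|exact: cmeasurable_expi].
apply: cmeasurableM; last by apply: cmeasurableM; [exact: cmeasurable_cst|exact: den].
apply: cmeasurable_prod => j; apply: cmeasurableM; first exact: cmeasurable_cst.
apply: cmeasurableM; last exact: den.
by apply: cmeasurableD; [exact: cmeasurable_expi|exact: cmeasurable_cst].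
Qed.

End measurability.

Section integrals.
Context {R : realType}.
Local Notation T := (measurableTypeR R).
Local Notation mu := (circle_measure R).

(** Each step has length $2\pi\delta$, hence measure at most $\delta$; the part outside $[-\pi,\pi]$
    is lost. *)
Lemma integral_cells (delta : R) (g : T -> R) (I : finType) (lo e : I -> R) :
  0 <= delta -> measurable_fun setT g -> (forall x, 0 <= g x) -> (forall k, 0 <= e k) ->
  (forall x, - pi <= x -> x <= pi ->
    g x <= \sum_(k : I) (if lo k <= x <= lo k + 2 * pi * delta then e k else 0)) ->
  (\int[mu]_x (g x)%:E <= (delta * \sum_(k : I) e k)%:E)%E.
Proof.
move=> d0 mg g0 e0 ge.
have p0 : 0 < pi :> R by exact: pi_gt0.
rewrite integral_uniform; last 2 first.
- exact/measurable_EFinP.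
- by move=> x; rewrite lee_fin.
pose J k : set T := [set` `[lo k, lo k + 2 * pi * delta]].
have mJ k : measurable (J k) by exact: measurable_itv.
have h : (\int[lebesgue_measure]_(x in `[(- pi)%R, pi]) (g x)%:E <=
    (2 * pi * delta * \sum_(k : I) e k)%:E)%E.
  apply: (@le_trans _ _ (\int[lebesgue_measure]_(x in `[(- pi)%R, pi])
      (\sum_(k <- index_enum I) (e k)%:E * (\1_(J k) x)%:E))%E).
    apply: ge0_le_integral => //.
    - by move=> x _; rewrite lee_fin.
    - by apply/measurable_EFinP; exact: measurable_funTS.
    - apply: emeasurable_sum => k; apply/measurable_EFinP.
      by apply: measurable_funM => //; exact: measurable_funTS.
    - move=> x /=; rewrite in_itv/= => /andP[x1 x2].
      under eq_bigr do rewrite -EFinM.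
      rewrite sumEFin lee_fin; apply: (le_trans (ge _ x1 x2)).
      apply: ler_sum => k _; rewrite indicE /J mem_setE in_itv/=.
      by case: ifP; rewrite ?mulr1 ?mulr0.
  rewrite ge0_integral_sum//; last 2 first.
  - move=> k; apply/measurable_EFinP.
    by apply: measurable_funM => //; exact: measurable_funTS.
  - by move=> k x _; rewrite mule_ge0// lee_fin.
  rewrite mulr_sumr -sumEFin; apply: lee_sum => k _.
  rewrite ge0_integralZl//; last 2 first.
  - by apply/measurable_EFinP; exact: measurable_funTS.
  - by rewrite lee_fin.
  rewrite integral_indic// (mulrC (_ * delta)) [in leRHS]EFinM; apply: lee_wpmul2l; first by rewrite lee_fin.
  apply: (@le_trans _ _ (lebesgue_measure (J k))).
    by apply: le_measure; rewrite ?inE//; first [exact: subIsetl|exact: measurableI].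
  rewrite /J lebesgue_measure_itv/= lte_fin; case: ifP => _; last by rewrite lee_fin !mulr_ge0// ltW.
  by rewrite -EFinB lee_fin; lra.
apply: (le_trans (lee_wpmul2l _ h)); first by rewrite lee_fin invr_ge0; lra.
rewrite -EFinM lee_fin le_eqVlt; apply/orP; left; apply/eqP; field; lra.
Qed.

Definition sqr_integrable (f : T -> R[i]) : Prop :=
  cmeasurable f /\ (\int[mu]_x (modulus (f x) ^+ 2)%:E < +oo)%E.

Lemma integrable_sqr_modulus f : sqr_integrable f ->
  mu.-integrable setT (EFin \o (fun x => modulus (f x) ^+ 2)).
Proof.
move=> [mf foo]; apply/integrableP; split.
  by apply/measurable_EFinP; exact: measurable_sqr_modulus.
under eq_integral => x _ do rewrite /= ger0_norm ?sqr_ge0//.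
exact: foo.
Qed.

Lemma integrable_Mconj (h : R[i] -> R) f g : sqr_integrable f -> sqr_integrable g ->
  (forall z, `|h z| <= modulus z) ->
  measurable_fun setT (fun x => h (f x * (g x)^*)) ->
  mu.-integrable setT (EFin \o (fun x => h (f x * (g x)^*))).
Proof.
move=> sf sg hz mh.
have If := integrable_sqr_modulus sf; have Ig := integrable_sqr_modulus sg.
apply: (@le_integrable _ _ _ _ _ _ _ (EFin \o (fun x => modulus (f x) ^+ 2) \+
  (EFin \o (fun x => modulus (g x) ^+ 2)))) => //.
- exact/measurable_EFinP.
- move=> x _ /=; rewrite lee_fin.
  apply: (le_trans (hz _)); rewrite modulusM modulusJ ger0_norm ?addr_ge0 ?sqr_ge0//.
  have := sqr_ge0 (modulus (f x) - modulus (g x)); have := sqr_ge0 (modulus (f x) + modulus (g x)).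
  lra.
- exact: integrableD.
Qed.

Lemma modulus_ge_Im (z : R[i]) : `|complex.Im z| <= modulus z.
Proof.
rewrite -(@ler_pXn2r _ 2)// ?nnegrE ?modulus_ge0// real_normK ?num_real// sqr_modulus.
by rewrite lerDr sqr_ge0.
Qed.

Lemma integrable_ReMconj f g : sqr_integrable f -> sqr_integrable g ->
  mu.-integrable setT (EFin \o (fun x => complex.Re (f x * (g x)^*))).
Proof.
move=> sf sg; apply: (@integrable_Mconj (@complex.Re R)) => //; first exact: modulus_ge_Re.
by have [] := cmeasurableM sf.1 (cmeasurable_conj sg.1).
Qed.

Lemma integrable_ImMconj f g : sqr_integrable f -> sqr_integrable g ->
  mu.-integrable setT (EFin \o (fun x => complex.Im (f x * (g x)^*))).
Proof.
move=> sf sg; apply: (@integrable_Mconj (@complex.Im R)) => //; first exact: modulus_ge_Im.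
by have [] := cmeasurableM sf.1 (cmeasurable_conj sg.1).
Qed.

End integrals.

(** * Bessel's inequality by duality and the maximal inequality *)

Lemma mul_le_weighted (R : realFieldType) (A p q : R) : 0 < A ->
  p * q <= A / 2 * p ^+ 2 + A^-1 / 2 * q ^+ 2.
Proof.
move=> A0; have : 0 <= A^-1 * (A * p - q) ^+ 2 by rewrite mulr_ge0 ?sqr_ge0// invr_ge0 ltW.
have -> : A^-1 * (A * p - q) ^+ 2 = A * p ^+ 2 - 2 * (p * q) + A^-1 * q ^+ 2 by field; lra.
lra.
Qed.

(** The second bound turns the last term into [X / 2], which is absorbed on the left. *)
Lemma le_of_weighted (R : realFieldType) (A X a b : R) : 0 < A ->
  X <= A / 2 * a + A^-1 / 2 * b -> b <= A * X -> X <= A * a.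
Proof.
move=> A0 hX bX; have : A^-1 * b <= X by rewrite mulrC ler_pdivrMr// mulrC.
lra.
Qed.

Section final.
Context {R : realType}.
Variable r : R.
Hypothesis r_gt : 2^-1 < r.
Hypothesis r_lt : r < 1.
Local Notation T := (measurableTypeR R).
Local Notation mu := (circle_measure R).
Local Notation L := (points_length r).
Local Notation A := (@pointwise_bound R).

Definition partial_MT (c : nat -> R[i]) (n : nat) (x : T) : R[i] :=
  \sum_(0 <= j < n) c j * MT (points r) j (expi x).

Definition max_MT (c : nat -> R[i]) (x : T) : R :=
  \big[Num.max/0]_(0 <= n < L) modulus (partial_MT c n.+1 x).

Lemma pointwise_bound_gt0 : 0 < A.
Proof.
have := left_bound_ge0 R; rewrite /pointwise_bound /arc_bound => h.
apply: mulr_gt0; first lra.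
by apply: ltr_wpDl; [apply: mulr_ge0; lra|lra].
Qed.

Lemma cmeasurable_partial_MT c n : cmeasurable (partial_MT c n).
Proof.
apply: cmeasurable_sum => j; apply: cmeasurableM; first exact: cmeasurable_cst.
exact: cmeasurable_MT.
Qed.

Lemma measurable_max_MT c : measurable_fun setT (max_MT c).
Proof.
rewrite /max_MT; elim: (index_iota 0 L) => [|n s IH].
  by under eq_fun do rewrite big_nil; exact: measurable_cst.
under eq_fun do rewrite big_cons.
apply: measurable_maxr => //; apply: measurable_modulus; exact: cmeasurable_partial_MT.
Qed.

Lemma sqr_max_MT_le c x (B : R) : 0 <= B ->
  (forall n, (n <= L)%N -> modulus (partial_MT c n x) ^+ 2 <= B) -> max_MT c x ^+ 2 <= B.
Proof.
move=> B0 h; rewrite /max_MT big_nat; elim/big_ind: _ => [|a b ha hb|n /andP[_ nL]].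
- by rewrite expr0n.
- by rewrite /Num.max; case: ifP.
- exact: h.
Qed.

Lemma sqr_partial_MT_integral c n : (n <= L)%N ->
  (\int[mu]_x (modulus (partial_MT c n x) ^+ 2)%:E <=
   (A * \sum_(j < L) modulus (c j) ^+ 2)%:E)%E.
Proof.
have [rg rl] := (r_gt, r_lt).
move=> nL; have [I [lo [e [e0 es eb]]]] := maximal_pointwise rg rl c.
have d0 : 0 < 1 - r by lra.
apply: (@le_trans _ _ ((1 - r) * \sum_(k : I) e k)%:E); last first.
  rewrite lee_fin; apply: (le_trans (ler_wpM2l (ltW d0) es)).
  by rewrite mulrA mulrCA divff ?gt_eqF// mulr1.
apply: (integral_cells (lo := lo)) => //; first exact: ltW.
- by apply: measurable_sqr_modulus; exact: cmeasurable_partial_MT.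
- by move=> x; exact: sqr_ge0.
- by move=> x x1 x2; exact: eb.
Qed.

Lemma sqr_max_MT_integral c :
  (\int[mu]_x (max_MT c x ^+ 2)%:E <=
   (A * \sum_(j < L) modulus (c j) ^+ 2)%:E)%E.
Proof.
have [rg rl] := (r_gt, r_lt).
have [I [lo [e [e0 es eb]]]] := maximal_pointwise rg rl c.
have d0 : 0 < 1 - r by lra.
apply: (@le_trans _ _ ((1 - r) * \sum_(k : I) e k)%:E); last first.
  rewrite lee_fin; apply: (le_trans (ler_wpM2l (ltW d0) es)).
  by rewrite mulrA mulrCA divff ?gt_eqF// mulr1.
apply: (integral_cells (lo := lo)) => //; first exact: ltW.
- by apply: measurable_funX; exact: measurable_max_MT.
- by move=> x; exact: sqr_ge0.
- move=> x x1 x2; apply: sqr_max_MT_le => [|n nL]; last exact: eb.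
  by apply: sumr_ge0 => k _; case: ifP.
Qed.

Lemma sqr_integrable_partial_MT c n : (n <= L)%N -> sqr_integrable (partial_MT c n).
Proof.
move=> nL; split; first exact: cmeasurable_partial_MT.
by apply: le_lt_trans (sqr_partial_MT_integral c nL) _; rewrite ltry.
Qed.

(** Each function is the partial sum whose coefficients are those of a unit vector. *)
Lemma sqr_integrable_MT j : (j < L)%N -> sqr_integrable (fun x => MT (points r) j (expi x)).
Proof.
move=> jL; have := sqr_integrable_partial_MT (fun i => if i == j then 1 else 0) (leqnn L).
congr sqr_integrable; apply/funext => x; rewrite /partial_MT.
rewrite big_mkord (bigD1 (Ordinal jL))//= eqxx mul1r big1 ?addr0// => i ij.
by rewrite ifN ?mul0r//; apply: contraNneq ij => ij; apply/eqP/val_inj.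
Qed.

Lemma L2norm_sqr (f : R[i] -> R[i]) :
  (L2norm f `^ 2 = \int[mu]_x (modulus (f (expi x)) ^+ 2)%:E)%E.
Proof.
rewrite /L2norm poweR_Lnorm//; apply: eq_integral => x _.
by rewrite /= ger0_norm ?modulus_ge0// powR_mulrn ?modulus_ge0.
Qed.

Lemma sqr_integrable_in_L2 (f : R[i] -> R[i]) : in_L2 f -> sqr_integrable (fun x => f (expi x)).
Proof.
move=> [f1 f2 foo]; split; first by split.
by rewrite -L2norm_sqr; exact: poweR_lty.
Qed.

(* Dual to [sqr_partial_MT_integral]. *)
Lemma sum_inner_MT_le (f : R[i] -> R[i]) : in_L2 f ->
  ((\sum_(j < L) modulus (inner f (MT (points r) j)) ^+ 2)%:E <=
   A%:E * \int[mu]_x (modulus (f (expi x)) ^+ 2)%:E)%E.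
Proof.
move=> /sqr_integrable_in_L2 sf.
pose c j := inner f (MT (points r) j).
pose g j x := MT (points r) j (expi x : R[i]).
pose F := partial_MT c L.
have sF : sqr_integrable F by exact: sqr_integrable_partial_MT.
pose h x := complex.Re (f (expi x) * (F x)^*).
have mT : measurable (setT : set T) by exact: measurableT.
have Ih : mu.-integrable setT (EFin \o h) by exact: integrable_ReMconj.
set X := \sum_(j < L) modulus _ ^+ 2.
(* Pairing [f] with the sum built from its own coefficients returns the sum of their squared
   moduli. *)
have E : (\int[mu]_x (h x)%:E = X%:E)%E.
  pose u j x := complex.Re (f (expi x) * (g j x)^*).
  pose v j x := complex.Im (f (expi x) * (g j x)^*).
  have Iu (j : 'I_L) : mu.-integrable setT (EFin \o u j).
    by apply: integrable_ReMconj => //; exact: sqr_integrable_MT.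
  have Iv (j : 'I_L) : mu.-integrable setT (EFin \o v j).
    by apply: integrable_ImMconj => //; exact: sqr_integrable_MT.
  have Iau (j : 'I_L) := integrableZl mT (complex.Re (c j)) (Iu j).
  have Ibv (j : 'I_L) := integrableZl mT (complex.Im (c j)) (Iv j).
  have Ij (j : 'I_L) := integrableD mT (Iau j) (Ibv j).
  transitivity (\int[mu]_x (\sum_(j < L) ((complex.Re (c j))%:E * (u j x)%:E +
      (complex.Im (c j))%:E * (v j x)%:E)))%E.
    apply: eq_integral => x _; under eq_bigr do rewrite -!EFinM -EFinD.
    rewrite sumEFin; congr EFin.
    rewrite /h /F /partial_MT conj_sum mulr_sumr Re_sum big_mkord; apply: eq_bigr => j _.
    rewrite /u /v -/(g j x) conjM !conjE.
    by case: (c j) (f _) (g j x) => a b [a' b'] [a'' b'']; rewrite /=; ring.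
  rewrite (integral_sum mT Ij) -sumEFin; apply: eq_bigr => j _.
  rewrite (integralD mT (Iau j) (Ibv j)) (integralZl mT (Iu j)) (integralZl mT (Iv j)).
  have -> : (\int[mu]_x (EFin \o u j) x = (complex.Re (c j))%:E)%E.
    by rewrite /c /inner/= fineK//; exact: (integrable_fin_num mT (Iu j)).
  have -> : (\int[mu]_x (EFin \o v j) x = (complex.Im (c j))%:E)%E.
    by rewrite /c /inner/= fineK//; exact: (integrable_fin_num mT (Iv j)).
  by rewrite -!EFinM -EFinD sqr_modulus.
have A0 := pointwise_bound_gt0.
have If := integrable_sqr_modulus sf; have IF := integrable_sqr_modulus sF.
pose a := \int[mu]_x (modulus (f (expi x)) ^+ 2); pose b := \int[mu]_x (modulus (F x) ^+ 2).
have aE : (\int[mu]_x (modulus (f (expi x)) ^+ 2)%:E = a%:E)%E.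
  by rewrite /a /Rintegral fineK//; exact: (integrable_fin_num mT If).
have bE : (\int[mu]_x (modulus (F x) ^+ 2)%:E = b%:E)%E.
  by rewrite /b /Rintegral fineK//; exact: (integrable_fin_num mT IF).
have bX : b <= A * X.
  by rewrite -lee_fin -bE; exact: sqr_partial_MT_integral.
have XE : X = \int[mu]_x h x by rewrite /Rintegral E.
have If' := integrableZl mT (A / 2) If; have IF' := integrableZl mT (A^-1 / 2) IF.
have hX : X <= A / 2 * a + A^-1 / 2 * b.
  rewrite XE /a /b -RintegralZl// -RintegralZl// -RintegralD//.
  apply: le_Rintegral => //; first exact: (integrableD mT If' IF').
  move=> x _; rewrite /h.
  apply: (le_trans (ler_norm _)); apply: (le_trans (modulus_ge_Re _)).
  rewrite modulusM modulusJ; set p := modulus _; set q := modulus _.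
  exact: mul_le_weighted.
rewrite aE -EFinM lee_fin; exact: le_of_weighted hX bX.
Qed.

Lemma maximal_L2 (f : R[i] -> R[i]) : in_L2 f ->
  (L2norm (fun z => (MT_maximal L (points r) f z)%:C) <= A%:E * L2norm f)%E.
Proof.
move=> fL2; have A0 := pointwise_bound_gt0.
pose c j := inner f (MT (points r) j).
have l0 : (0 <= L2norm f)%E by exact: Lnorm_ge0.
set N := L2norm (fun z => _); have N0 : (0 <= N)%E by exact: Lnorm_ge0.
(* One factor [A] comes from the maximal bound for the coefficients, the other from Bessel's
   inequality. *)
have sq : (N `^ 2 <= (A%:E * L2norm f) `^ 2)%E.
  rewrite poweRM ?lee_fin ?(ltW A0)// /N !L2norm_sqr.
  have -> : (\int[mu]_x (modulus (MT_maximal L (points r) f (expi x))%:C ^+ 2)%:E =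
      \int[mu]_x (max_MT c x ^+ 2)%:E)%E.
    by apply: eq_integral => x _; rewrite modulusR real_normK ?num_real.
  have -> : (A%:E `^ 2 = A%:E * A%:E)%E.
    by rewrite poweR_EFin powR_mulrn ?(ltW A0)// expr2 EFinM.
  apply: (le_trans (sqr_max_MT_integral c)); rewrite -muleA [leLHS]EFinM.
  by apply: lee_wpmul2l; [rewrite lee_fin ltW|exact: sum_inner_MT_le].
have := @gt0_ler_poweR R 2^-1 _; rewrite invr_ge0 => /(_ (ler0n _ 2)) h.
have {h} := h (N `^ 2)%E ((A%:E * L2norm f) `^ 2)%E.
rewrite !in_itv/= !leey !andbT !poweR_ge0 => /(_ isT isT sq).
by rewrite -!poweRrM divff// !poweRe1// mule_ge0// lee_fin ltW.
Qed.

End final.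

Theorem theorem1 (R : realType) :
  exists C : R, 0 < C /\
    forall r : R, 2^-1 < r -> r < 1 ->
    forall f : R[i] -> R[i], in_L2 f ->
      (L2norm (fun z => (MT_maximal (points_length r) (points r) f z)%:C)
         <= C%:E * L2norm f)%E.
Proof.
exists (@pointwise_bound R); split; first exact: pointwise_bound_gt0.
by move=> r r_gt r_lt f fL2; exact: maximal_L2.
Qed.
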